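(* Let $\mathcal{C}$ be a (not necessarily finite) semisimple braided tensor category with a contragredient functor $\mathsf{X}\mapsto\mathsf{X}'$, and let $\mathrm{Irr}(\mathcal{C})$ be a set of representatives of the isomorphism classes of simple objects of $\mathcal{C}$. Then $$\mathsf{A}=\bigoplus_{\mathsf{X}\in\mathrm{Irr}(\mathcal{C})}\mathsf{X}'\boxtimes\mathsf{X}$$ is a commutative associative algebra in $(\mathcal{C}\boxtimes\mathcal{C}^{\mathrm{rev}})_\oplus$ (that is, it carries such an algebra structure). Moreover, if $\mathcal{C}$ is rigid (with $\mathsf X'=\mathsf X^*$ the dual), then this algebra $\mathsf{A}$ is simple, and for simple objects $\mathsf{X},\mathsf{Y},\mathsf{Z}$ of $\mathcal{C}$ its multiplication rules are given by $M_{\mathsf{X}^*\boxtimes\mathsf{X},\,\mathsf{Y}^*\boxtimes\mathsf{Y}}^{\mathsf{Z}^*\boxtimes\mathsf{Z}}=1$ if and only if $\mathsf{Z}$ is a direct summand of $\mathsf{X}\otimes\mathsf{Y}$.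
   Context: All categories are linear over a fixed field $\mathbb{F}$ (one may take $\mathbb{F}=\mathbb{C}$). A tensor category is an abelian monoidal category with bilinear tensor product $\otimes$, unit object $\mathbf{1}$, unit isomorphisms $l_{\mathsf X}:\mathbf 1\otimes\mathsf X\to\mathsf X$, $r_{\mathsf X}:\mathsf X\otimes\mathbf 1\to\mathsf X$ and associativity isomorphisms $\mathcal A_{\mathsf X,\mathsf Y,\mathsf Z}:\mathsf X\otimes(\mathsf Y\otimes\mathsf Z)\to(\mathsf X\otimes\mathsf Y)\otimes\mathsf Z$ satisfying triangle and pentagon axioms, such that $\mathsf X\otimes\bullet$ and $\bullet\otimes\mathsf X$ are right exact; it is not assumed rigid or finite. The unit object is simple and simple objects have endomorphism algebra $\mathbb F$. Braided means equipped with natural braiding isomorphisms $\mathcal R_{\mathsf X,\mathsf Y}:\mathsf X\otimes\mathsf Y\to\mathsf Y\otimes\mathsf X$ satisfying the hexagon axioms. Semisimple means every object is a finite direct sum of simple objects; there may be infinitely many isomorphism classes of simples. A contragredient functor on $\mathcal C$ is a contravariant functor $\mathsf X\mapsto\mathsf X'$, $f\mapsto f'$ from $\mathcal C$ to itself that permutes the simple objects, together with isomorphisms $\Gamma_{\mathsf X,\mathsf Y}:\mathrm{Hom}_{\mathcal C}(\mathsf X\otimes\mathsf Y,\mathbf 1)\to\mathrm{Hom}_{\mathcal C}(\mathsf X,\mathsf Y')$ natural in the sense that $\Gamma_{\mathsf X_1,\mathsf Y_1}(F\circ(f\otimes g))=g'\circ\Gamma_{\mathsf X_2,\mathsf Y_2}(F)\circ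 f$ for $f:\mathsf X_1\to\mathsf X_2$, $g:\mathsf Y_1\to\mathsf Y_2$. If $\mathcal C$ is rigid and braided, the duality functor $*$ is a contragredient functor. $\mathcal C^{\mathrm{rev}}$ is $\mathcal C$ as a tensor category, with reversed braiding $\mathcal R^{\mathrm{rev}}_{\mathsf X,\mathsf Y}=\mathcal R_{\mathsf Y,\mathsf X}^{-1}$. $\mathcal C\boxtimes\mathcal C^{\mathrm{rev}}$ is the Deligne product with its componentwise braided tensor structure. For a category $\mathcal D$, the direct sum completion $\mathcal D_\oplus$ has as objects formal direct sums $\bigoplus_{s\in S}\mathsf X_s$ ($S$ any set, $\mathsf X_s$ in $\mathcal D$); a morphism $\bigoplus_{s\in S}\mathsf X_s\to\bigoplus_{t\in T}\mathsf Y_t$ is a family $(f_{s,t})$, $f_{s,t}\in\mathrm{Hom}_{\mathcal D}(\mathsf X_s,\mathsf Y_t)$, such that for each $s$ one has $f_{s,t}=0$ for all but finitely many $t$; braided tensor structures on $\mathcal D$ extend componentwise to $\mathcal D_\oplus$. An associative algebra $(\mathsf A,\mu,\iota)$ in a tensor category has $\mu:\mathsf A\otimes\mathsf A\to\mathsf A$, $\iota:\mathbf 1\to\mathsf A$ with $\mu\circ(\mathrm{Id}\otimes\mu)=\mu\circ(\mu\otimes\mathrm{Id})\circ\mathcal A_{\mathsf A,\mathsf A,\mathsf A}$, $\mu\circ(\iota\otimes\mathrm{Id})=l_{\mathsf A}$, $\mu\circ(\mathrm{Id}\otimes\iota)=r_{\mathsf A}$; it is commutative if $\mu\circ\mathcal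 R_{\mathsf A,\mathsf A}=\mu$, and simple if it has no ideals other than $0$ and $\mathsf A$. For simple subobjects $\mathsf P,\mathsf Q,\mathsf R$ of a completely reducible algebra $\mathsf A$, the multiplication rule $M_{\mathsf P,\mathsf Q}^{\mathsf R}$ is $1$ if $\mathsf R\subseteq\mathrm{Image}(\mu|_{\mathsf P\otimes\mathsf Q}\to\mathsf A)$ and $0$ otherwise. *)

(* Defs.v *)
From HB Require Import structures.
From mathcomp Require Import all_boot all_algebra.
From mathcomp Require Import boolp classical_sets functions cardinality fsbigop.
Set Implicit Arguments.
Unset Strict Implicit.
Unset Printing Implicit Defensive.
Import GRing.Theory.
Local Open Scope classical_set_scope.
Local Open Scope ring_scope.

Declare Scope cat_scope.
Delimit Scope cat_scope with cat.

Record lincat (F : fieldType) := LinCat {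
  ob :> Type;
  Mor : ob -> ob -> lmodType F;
  idm : forall X, Mor X X;
  compm : forall X Y Z, Mor Y Z -> Mor X Y -> Mor X Z;
  compA : forall X Y Z W (h : Mor Z W) (g : Mor Y Z) (f : Mor X Y),
    compm h (compm g f) = compm (compm h g) f;
  comp1m : forall X Y (f : Mor X Y), compm (idm Y) f = f;
  compm1 : forall X Y (f : Mor X Y), compm f (idm X) = f;
  comp_linl : forall X Y Z a (g1 g2 : Mor Y Z) (f : Mor X Y),
    compm (a *: g1 + g2) f = a *: compm g1 f + compm g2 f;
  comp_linr : forall X Y Z a (g : Mor Y Z) (f1 f2 : Mor X Y),
    compm g (a *: f1 + f2) = a *: compm g f1 + compm g f2 }.

Arguments Mor {F C} X Y : rename.
Arguments idm {F C} X : rename.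
Arguments compm {F C X Y Z} g f : rename.

Notation "g ∘ f" := (compm g f)
  (at level 40, left associativity, format "g  ∘  f") : cat_scope.
Local Open Scope cat_scope.

Section LinCatTheory.
Variables (F : fieldType) (C : lincat F).
Implicit Types X Y Z : C.

Record iso X Y := Iso {
  fwd :> Mor X Y;
  bwd : Mor Y X;
  bwdK : bwd ∘ fwd = idm X;
  fwdK : fwd ∘ bwd = idm Y }.

Definition iso_sym X Y (f : iso X Y) : iso Y X := Iso (fwdK f) (bwdK f).

Definition isomorphic X Y : Prop := inhabited (iso X Y).

Definition is_iso X Y (f : Mor X Y) : Prop :=
  exists g : Mor Y X, g ∘ f = idm X /\ f ∘ g = idm Y.

Definition mono X Y (f : Mor X Y) : Prop :=
  forall W (g h : Mor W X), f ∘ g = f ∘ h -> g = h.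

Definition epi X Y (f : Mor X Y) : Prop :=
  forall W (g h : Mor Y W), g ∘ f = h ∘ f -> g = h.

Definition is_kernel K X Y (k : Mor K X) (f : Mor X Y) : Prop :=
  f ∘ k = 0 /\
  forall W (g : Mor W X), f ∘ g = 0 -> exists! h : Mor W K, k ∘ h = g.

Definition is_cokernel X Y Q (f : Mor X Y) (q : Mor Y Q) : Prop :=
  q ∘ f = 0 /\
  forall W (g : Mor Y W), g ∘ f = 0 -> exists! h : Mor Q W, h ∘ q = g.

Definition is_zero X : Prop := idm X = 0.

(* For [n = 0] this says that [X] is a zero object. *)
Definition is_dirsum n (S : 'I_n -> C) X
    (i : forall k, Mor (S k) X) (p : forall k, Mor X (S k)) : Prop :=
  [/\ forall k, p k ∘ i k = idm (S k),
      forall j k, j != k -> p k ∘ i j = 0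
    & \sum_k i k ∘ p k = idm X].

Definition dirsum n (S : 'I_n -> C) X : Prop :=
  exists i p, @is_dirsum n S X i p.

Definition is_abelian : Prop :=
  [/\ forall n (S : 'I_n -> C), exists X, dirsum S X,
      forall X Y (f : Mor X Y), exists K (k : Mor K X), is_kernel k f,
      forall X Y (f : Mor X Y), exists Q (q : Mor Y Q), is_cokernel f q,
      forall X Y (f : Mor X Y), mono f -> exists Z (g : Mor Y Z), is_kernel f g
    & forall X Y (f : Mor X Y), epi f -> exists Z (g : Mor Z X), is_cokernel g f].

Definition simple X : Prop :=
  ~ is_zero X /\ forall Y (m : Mor Y X), mono m -> is_zero Y \/ is_iso m.

Definition semisimple : Prop :=
  forall X, exists n (S : 'I_n -> C), (forall k, simple (S k)) /\ dirsum S X.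

Definition schur : Prop :=
  forall X, simple X -> forall f : Mor X X, exists a : F, f = a *: idm X.

Definition direct_summand Z X : Prop :=
  exists (i : Mor Z X) (p : Mor X Z), p ∘ i = idm Z.

Definition irr_representatives (I : Type) (irr : I -> C) : Prop :=
  [/\ forall i, simple (irr i),
      forall i j, isomorphic (irr i) (irr j) -> i = j
    & forall X, simple X -> exists i, isomorphic X (irr i)].

Definition factors_through W X Y (f : Mor W Y) (m : Mor X Y) : Prop :=
  exists g : Mor W X, m ∘ g = f.

Definition is_image X Y (f : Mor X Y) J (m : Mor J Y) : Prop :=
  [/\ mono m, factors_through f m
    & forall J' (m' : Mor J' Y), mono m' -> factors_through f m' ->
        factors_through m m'].

Lemma comp0m X Y Z (f : Mor X Y) : (0 : Mor Y Z) ∘ f = 0.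
Proof.
have := comp_linl 1 (0 : Mor Y Z) 0 f; rewrite !scale1r addr0 => e.
by apply: (addrI ((0 : Mor Y Z) ∘ f)); rewrite -e addr0.
Qed.

Lemma compm0 X Y Z (g : Mor Y Z) : g ∘ (0 : Mor X Y) = 0.
Proof.
have := comp_linr 1 g (0 : Mor X Y) 0; rewrite !scale1r addr0 => e.
by apply: (addrI (g ∘ (0 : Mor X Y))); rewrite -e addr0.
Qed.

Lemma compDl X Y Z (g1 g2 : Mor Y Z) (f : Mor X Y) :
  (g1 + g2) ∘ f = g1 ∘ f + g2 ∘ f.
Proof. by have := comp_linl 1 g1 g2 f; rewrite !scale1r. Qed.

Lemma compDr X Y Z (g : Mor Y Z) (f1 f2 : Mor X Y) :
  g ∘ (f1 + f2) = g ∘ f1 + g ∘ f2.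
Proof. by have := comp_linr 1 g f1 f2; rewrite !scale1r. Qed.

Lemma comp_suml X Y Z (J : Type) (r : seq J) (g : J -> Mor Y Z) (f : Mor X Y) :
  (\sum_(j <- r) g j) ∘ f = \sum_(j <- r) (g j ∘ f).
Proof.
by apply: (big_morph (fun g => g ∘ f)) => [g1 g2|]; rewrite (compDl, comp0m).
Qed.

Lemma comp_sumr X Y Z (J : Type) (r : seq J) (g : Mor Y Z) (f : J -> Mor X Y) :
  g ∘ (\sum_(j <- r) f j) = \sum_(j <- r) (g ∘ f j).
Proof.
by apply: (big_morph (fun f => g ∘ f)) => [f1 f2|]; rewrite (compDr, compm0).
Qed.

Lemma iso_epi_eq X Y Z (f : iso X Y) (g h : Mor Z X) :
  f ∘ g = f ∘ h -> g = h.
Proof.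
by move=> e; rewrite -(comp1m g) -(comp1m h) -(bwdK f) -!compA e.
Qed.

End LinCatTheory.

Record linfun (F : fieldType) (C D : lincat F) := LinFun {
  fob :> C -> D;
  fmor : forall X Y : C, Mor X Y -> Mor (fob X) (fob Y);
  fmor_id : forall X, fmor (idm X) = idm (fob X);
  fmor_comp : forall X Y Z (g : Mor Y Z) (f : Mor X Y),
    fmor (g ∘ f) = fmor g ∘ fmor f;
  fmor_lin : forall X Y a (f g : Mor X Y),
    fmor (a *: f + g) = a *: fmor f + fmor g }.

Record bilfun (F : fieldType) (C1 C2 D : lincat F) := BilFun {
  bob :> C1 -> C2 -> D;
  bmor : forall (X1 Y1 : C1) (X2 Y2 : C2),
    Mor X1 Y1 -> Mor X2 Y2 -> Mor (bob X1 X2) (bob Y1 Y2);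
  bmor_id : forall X1 X2, bmor (idm X1) (idm X2) = idm (bob X1 X2);
  bmor_comp : forall (X1 Y1 Z1 : C1) (X2 Y2 Z2 : C2)
      (g1 : Mor Y1 Z1) (f1 : Mor X1 Y1) (g2 : Mor Y2 Z2) (f2 : Mor X2 Y2),
    bmor (g1 ∘ f1) (g2 ∘ f2) = bmor g1 g2 ∘ bmor f1 f2;
  bmor_linl : forall (X1 Y1 : C1) (X2 Y2 : C2) a
      (f g : Mor X1 Y1) (h : Mor X2 Y2),
    bmor (a *: f + g) h = a *: bmor f h + bmor g h;
  bmor_linr : forall (X1 Y1 : C1) (X2 Y2 : C2) a
      (h : Mor X1 Y1) (f g : Mor X2 Y2),
    bmor h (a *: f + g) = a *: bmor h f + bmor h g }.

Arguments bmor {F C1 C2 D} B {X1 Y1 X2 Y2} f g : rename.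

Section Functors.
Variable F : fieldType.

Definition right_exact (C D : lincat F) (H : linfun C D) : Prop :=
  forall (X Y Q : C) (f : Mor X Y) (q : Mor Y Q),
    is_cokernel f q -> is_cokernel (fmor H f) (fmor H q).

Definition biright_exact (C1 C2 D : lincat F) (B : bilfun C1 C2 D) : Prop :=
  (forall (X1 Y1 Q1 : C1) (X2 : C2) (f : Mor X1 Y1) (q : Mor Y1 Q1),
     is_cokernel f q -> is_cokernel (bmor B f (idm X2)) (bmor B q (idm X2))) /\
  (forall (X1 : C1) (X2 Y2 Q2 : C2) (f : Mor X2 Y2) (q : Mor Y2 Q2),
     is_cokernel f q -> is_cokernel (bmor B (idm X1) f) (bmor B (idm X1) q)).

Definition natural (C D : lincat F) (H K : linfun C D)
    (b : forall X : C, Mor (H X) (K X)) : Prop :=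
  forall (X Y : C) (f : Mor X Y), b Y ∘ fmor H f = fmor K f ∘ b X.

Definition binatural (C1 C2 D : lincat F) (B G : bilfun C1 C2 D)
    (b : forall X1 X2, Mor (B X1 X2) (G X1 X2)) : Prop :=
  forall (X1 Y1 : C1) (X2 Y2 : C2) (f : Mor X1 Y1) (g : Mor X2 Y2),
    b Y1 Y2 ∘ bmor B f g = bmor G f g ∘ b X1 X2.

Section PostComp.
Variables (C1 C2 D E : lincat F) (H : linfun D E) (B : bilfun C1 C2 D).
Let pmor (X1 Y1 : C1) (X2 Y2 : C2) (f : Mor X1 Y1) (g : Mor X2 Y2) :
  Mor (H (B X1 X2)) (H (B Y1 Y2)) := fmor H (bmor B f g).

Fact postcomp_id X1 X2 : pmor (idm X1) (idm X2) = idm (H (B X1 X2)).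
Proof. by rewrite /pmor bmor_id fmor_id. Qed.

Fact postcomp_comp (X1 Y1 Z1 : C1) (X2 Y2 Z2 : C2)
    (g1 : Mor Y1 Z1) (f1 : Mor X1 Y1) (g2 : Mor Y2 Z2) (f2 : Mor X2 Y2) :
  pmor (g1 ∘ f1) (g2 ∘ f2) = pmor g1 g2 ∘ pmor f1 f2.
Proof. by rewrite /pmor bmor_comp fmor_comp. Qed.

Fact postcomp_linl (X1 Y1 : C1) (X2 Y2 : C2) a
    (f g : Mor X1 Y1) (h : Mor X2 Y2) :
  pmor (a *: f + g) h = a *: pmor f h + pmor g h.
Proof. by rewrite /pmor bmor_linl fmor_lin. Qed.

Fact postcomp_linr (X1 Y1 : C1) (X2 Y2 : C2) a
    (h : Mor X1 Y1) (f g : Mor X2 Y2) :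
  pmor h (a *: f + g) = a *: pmor h f + pmor h g.
Proof. by rewrite /pmor bmor_linr fmor_lin. Qed.

Definition postcomp : bilfun C1 C2 E :=
  BilFun postcomp_id postcomp_comp postcomp_linl postcomp_linr.

End PostComp.

(* The universal property: for every abelian linear category [E], composition
   with [B] is an equivalence from the category of right exact linear functors
   [D -> E] to the category of bilinear bifunctors [C1 * C2 -> E] that are
   right exact in each variable (essential surjectivity, full faithfulness). *)
Definition deligne_product (C1 C2 D : lincat F) (B : bilfun C1 C2 D) : Prop :=
  [/\ is_abelian D, biright_exact B &
    forall E : lincat F, is_abelian E ->
      (forall G : bilfun C1 C2 E, biright_exact G ->
         exists H : linfun D E, right_exact H /\
         exists b : forall X1 X2, iso (postcomp H B X1 X2) (G X1 X2),
           binatural b) /\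
      (forall H K : linfun D E, right_exact H -> right_exact K ->
         forall a : forall X1 X2, Mor (postcomp H B X1 X2) (postcomp K B X1 X2),
         binatural a ->
         exists b : forall X, Mor (H X) (K X),
           [/\ natural b,
               forall X1 X2, b (B X1 X2) = a X1 X2
             & forall b' : forall X, Mor (H X) (K X), natural b' ->
                 (forall X1 X2, b' (B X1 X2) = a X1 X2) ->
                 forall X, b' X = b X])].

End Functors.

Record moncat (F : fieldType) := MonCat {
  mcat :> lincat F;
  tens : bilfun mcat mcat mcat;
  one : mcat;
  lun : forall X, iso (tens one X) X;
  run : forall X, iso (tens X one) X;
  assoc : forall X Y Z, iso (tens X (tens Y Z)) (tens (tens X Y) Z);
  lun_nat : forall X Y (f : Mor X Y),
    lun Y ∘ bmor tens (idm one) f = f ∘ lun X;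
  run_nat : forall X Y (f : Mor X Y),
    run Y ∘ bmor tens f (idm one) = f ∘ run X;
  assoc_nat : forall X X' Y Y' Z Z'
      (f : Mor X X') (g : Mor Y Y') (h : Mor Z Z'),
    assoc X' Y' Z' ∘ bmor tens f (bmor tens g h) =
    bmor tens (bmor tens f g) h ∘ assoc X Y Z;
  triangle : forall X Y,
    bmor tens (run X) (idm Y) ∘ assoc X one Y = bmor tens (idm X) (lun Y);
  pentagon : forall X Y Z W,
    assoc (tens X Y) Z W ∘ assoc X Y (tens Z W) =
    bmor tens (assoc X Y Z) (idm W) ∘ assoc X (tens Y Z) W ∘
      bmor tens (idm X) (assoc Y Z W) }.

Arguments tens {F C} : rename.
Arguments one {F C} : rename.
Arguments lun {F C} X : rename.
Arguments run {F C} X : rename.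
Arguments assoc {F C} X Y Z : rename.

Notation "X ⊗ Y" := (bob tens X Y)
  (at level 38, left associativity, format "X  ⊗  Y") : cat_scope.
Notation "f ⊗ₘ g" := (bmor tens f g)
  (at level 38, left associativity, format "f  ⊗ₘ  g") : cat_scope.
Notation "𝟙" := one : cat_scope.

Record brcat (F : fieldType) := BrCat {
  bcat :> moncat F;
  braid : forall X Y : bcat, iso (X ⊗ Y) (Y ⊗ X);
  braid_nat : forall (X X' Y Y' : bcat) (f : Mor X X') (g : Mor Y Y'),
    braid X' Y' ∘ (f ⊗ₘ g) = (g ⊗ₘ f) ∘ braid X Y;
  hexagon1 : forall X Y Z : bcat,
    braid X (Y ⊗ Z) =
    assoc Y Z X ∘ (idm Y ⊗ₘ braid X Z) ∘ bwd (assoc Y X Z) ∘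
      (braid X Y ⊗ₘ idm Z) ∘ assoc X Y Z :> Mor _ _;
  hexagon2 : forall X Y Z : bcat,
    braid (X ⊗ Y) Z =
    bwd (assoc Z X Y) ∘ (braid X Z ⊗ₘ idm Y) ∘ assoc X Z Y ∘
      (idm X ⊗ₘ braid Y Z) ∘ bwd (assoc X Y Z) :> Mor _ _ }.

Arguments braid {F C} X Y : rename.

Section Reverse.
Variables (F : fieldType) (C : brcat F).
Let rbraid (X Y : C) : iso (X ⊗ Y) (Y ⊗ X) := iso_sym (braid Y X).

Lemma tens_compl (X Y Z W : C) (g : Mor Y Z) (f : Mor X Y) :
  (g ∘ f) ⊗ₘ idm W = (g ⊗ₘ idm W) ∘ (f ⊗ₘ idm W).
Proof. by rewrite -bmor_comp comp1m. Qed.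

Lemma tens_compr (X Y Z W : C) (g : Mor Y Z) (f : Mor X Y) :
  idm W ⊗ₘ (g ∘ f) = (idm W ⊗ₘ g) ∘ (idm W ⊗ₘ f).
Proof. by rewrite -bmor_comp comp1m. Qed.

Fact rev_braid_nat (X X' Y Y' : C) (f : Mor X X') (g : Mor Y Y') :
  rbraid X' Y' ∘ (f ⊗ₘ g) = (g ⊗ₘ f) ∘ rbraid X Y.
Proof.
apply: (iso_epi_eq (f := braid Y' X')).
by rewrite !compA fwdK comp1m braid_nat -compA fwdK compm1.
Qed.

Fact rev_hexagon1 (X Y Z : C) :
  rbraid X (Y ⊗ Z) =
  assoc Y Z X ∘ (idm Y ⊗ₘ rbraid X Z) ∘ bwd (assoc Y X Z) ∘
    (rbraid X Y ⊗ₘ idm Z) ∘ assoc X Y Z :> Mor _ _.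
Proof.
apply: (iso_epi_eq (f := braid (Y ⊗ Z) X)); rewrite fwdK hexagon2.
have canc (A B D : C) (u : Mor A B) (v : Mor B A) (w : Mor D A) :
  v ∘ u = idm A -> v ∘ (u ∘ w) = w by move=> e; rewrite compA e comp1m.
rewrite -!compA (canc _ _ _ (fwd (assoc Y Z X))) ?bwdK //.
rewrite (canc _ _ _ (idm Y ⊗ₘ rbraid X Z)); last first.
  by rewrite -tens_compr fwdK bmor_id.
rewrite (canc _ _ _ (bwd (assoc Y X Z))) ?fwdK //.
rewrite (canc _ _ _ (rbraid X Y ⊗ₘ idm Z)) ?bwdK //.
by rewrite -tens_compl fwdK bmor_id.
Qed.

Fact rev_hexagon2 (X Y Z : C) :
  rbraid (X ⊗ Y) Z =
  bwd (assoc Z X Y) ∘ (rbraid X Z ⊗ₘ idm Y) ∘ assoc X Z Y ∘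
    (idm X ⊗ₘ rbraid Y Z) ∘ bwd (assoc X Y Z) :> Mor _ _.
Proof.
apply: (iso_epi_eq (f := braid Z (X ⊗ Y))); rewrite fwdK hexagon1.
have canc (A B D : C) (u : Mor A B) (v : Mor B A) (w : Mor D A) :
  v ∘ u = idm A -> v ∘ (u ∘ w) = w by move=> e; rewrite compA e comp1m.
rewrite -!compA (canc _ _ _ (bwd (assoc Z X Y))) ?fwdK //.
rewrite (canc _ _ _ (rbraid X Z ⊗ₘ idm Y)); last first.
  by rewrite -tens_compl fwdK bmor_id.
rewrite (canc _ _ _ (fwd (assoc X Z Y))) ?bwdK //.
rewrite (canc _ _ _ (idm X ⊗ₘ rbraid Y Z)) ?fwdK //.
by rewrite -tens_compr fwdK bmor_id.
Qed.

Definition rev_brcat : brcat F := BrCat rev_braid_nat rev_hexagon1 rev_hexagon2.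

End Reverse.

Definition tensor_category (F : fieldType) (C : moncat F) : Prop :=
  is_abelian C /\ biright_exact (tens : bilfun C C C).

(* [B] identifies the tensor products, units, associativity and unit
   isomorphisms and braidings of [D] with the componentwise ones, that is, it is
   a braided monoidal functor. *)
Record componentwise (F : fieldType) (C1 C2 D : brcat F) (B : bilfun C1 C2 D) :=
  Componentwise {
  cw : forall (X1 Y1 : C1) (X2 Y2 : C2),
    iso (B X1 X2 ⊗ B Y1 Y2) (B (X1 ⊗ Y1) (X2 ⊗ Y2));
  cw1 : iso (𝟙 : D) (B 𝟙 𝟙);
  cw_nat : forall (X1 X1' Y1 Y1' : C1) (X2 X2' Y2 Y2' : C2)
      (f1 : Mor X1 X1') (f2 : Mor X2 X2') (g1 : Mor Y1 Y1') (g2 : Mor Y2 Y2'),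
    cw X1' Y1' X2' Y2' ∘ (bmor B f1 f2 ⊗ₘ bmor B g1 g2) =
    bmor B (f1 ⊗ₘ g1) (f2 ⊗ₘ g2) ∘ cw X1 Y1 X2 Y2;
  cw_assoc : forall (X1 Y1 Z1 : C1) (X2 Y2 Z2 : C2),
    cw (X1 ⊗ Y1) Z1 (X2 ⊗ Y2) Z2 ∘ (cw X1 Y1 X2 Y2 ⊗ₘ idm (B Z1 Z2)) ∘
      assoc (B X1 X2) (B Y1 Y2) (B Z1 Z2) =
    bmor B (assoc X1 Y1 Z1) (assoc X2 Y2 Z2) ∘ cw X1 (Y1 ⊗ Z1) X2 (Y2 ⊗ Z2) ∘
      (idm (B X1 X2) ⊗ₘ cw Y1 Z1 Y2 Z2);
  cw_lun : forall (X1 : C1) (X2 : C2),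
    bmor B (lun X1) (lun X2) ∘ cw 𝟙 X1 𝟙 X2 ∘ (cw1 ⊗ₘ idm (B X1 X2)) =
    lun (B X1 X2);
  cw_run : forall (X1 : C1) (X2 : C2),
    bmor B (run X1) (run X2) ∘ cw X1 𝟙 X2 𝟙 ∘ (idm (B X1 X2) ⊗ₘ cw1) =
    run (B X1 X2);
  cw_braid : forall (X1 Y1 : C1) (X2 Y2 : C2),
    cw Y1 X1 Y2 X2 ∘ braid (B X1 X2) (B Y1 Y2) =
    bmor B (braid X1 Y1) (braid X2 Y2) ∘ cw X1 Y1 X2 Y2 }.

Record contragredient (F : fieldType) (C : moncat F) := Contragredient {
  cob :> C -> C;
  cmor : forall X Y : C, Mor X Y -> Mor (cob Y) (cob X);
  cmor_id : forall X, cmor (idm X) = idm (cob X);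
  cmor_comp : forall (X Y Z : C) (g : Mor Y Z) (f : Mor X Y),
    cmor (g ∘ f) = cmor f ∘ cmor g;
  cmor_lin : forall (X Y : C) a (f g : Mor X Y),
    cmor (a *: f + g) = a *: cmor f + cmor g;
  cob_simple : forall X, simple X -> simple (cob X);
  cob_inj : forall X Y, simple X -> simple Y ->
    isomorphic (cob X) (cob Y) -> isomorphic X Y;
  cob_surj : forall Y, simple Y -> exists2 X, simple X & isomorphic (cob X) Y;
  cgamma : forall X Y : C, Mor (X ⊗ Y) 𝟙 -> Mor X (cob Y);
  cgamma_lin : forall (X Y : C) a (f g : Mor (X ⊗ Y) 𝟙),
    cgamma (a *: f + g) = a *: cgamma f + cgamma g;
  cgamma_bij : forall X Y : C, bijective (@cgamma X Y);
  cgamma_nat : forall (X1 X2 Y1 Y2 : C) (f : Mor X1 X2) (g : Mor Y1 Y2)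
      (H : Mor (X2 ⊗ Y2) 𝟙),
    cgamma (H ∘ (f ⊗ₘ g)) = cmor g ∘ cgamma H ∘ f }.

(* [star X] is a (left) dual of [X], for all [X]; in a braided category left
   duals are also right duals, so such a structure is exactly rigidity. *)
Record duals (F : fieldType) (C : moncat F) (star : C -> C) := Duals {
  ev : forall X, Mor (star X ⊗ X) 𝟙;
  coev : forall X, Mor 𝟙 (X ⊗ star X);
  zigzag1 : forall X,
    run X ∘ (idm X ⊗ₘ ev X) ∘ bwd (assoc X (star X) X) ∘
      (coev X ⊗ₘ idm X) ∘ bwd (lun X) = idm X;
  zigzag2 : forall X,
    lun (star X) ∘ (ev X ⊗ₘ idm (star X)) ∘ assoc (star X) X (star X) ∘
      (idm (star X) ⊗ₘ coev X) ∘ bwd (run (star X)) = idm (star X) }.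

Record algebra (F : fieldType) (C : moncat F) (A : C) := Algebra {
  alg_mul : Mor (A ⊗ A) A;
  alg_unit : Mor 𝟙 A;
  alg_assoc : alg_mul ∘ (idm A ⊗ₘ alg_mul) =
    alg_mul ∘ (alg_mul ⊗ₘ idm A) ∘ assoc A A A;
  alg_unitl : alg_mul ∘ (alg_unit ⊗ₘ idm A) = lun A;
  alg_unitr : alg_mul ∘ (idm A ⊗ₘ alg_unit) = run A }.

Section Algebras.
Variable F : fieldType.

Definition commutative_algebra (C : brcat F) (A : C) (m : algebra A) : Prop :=
  alg_mul m ∘ braid A A = alg_mul m.

Definition ideal (C : moncat F) (A : C) (m : algebra A) J (j : Mor J A) : Prop :=
  [/\ mono j, factors_through (alg_mul m ∘ (idm A ⊗ₘ j)) j
    & factors_through (alg_mul m ∘ (j ⊗ₘ idm A)) j].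

Definition simple_algebra (C : moncat F) (A : C) (m : algebra A) : Prop :=
  forall J (j : Mor J A), ideal m j -> is_zero J \/ is_iso j.

Definition mult_rule (C : moncat F) (A : C) (m : algebra A) P Q R
    (p : Mor P A) (q : Mor Q A) (r : Mor R A) : nat :=
  `[< exists J (j : Mor J A),
        is_image (alg_mul m ∘ (p ⊗ₘ q)) j /\ factors_through r j >].

End Algebras.

Lemma fsum_seq (T : choiceType) (M : nmodType) (r : seq T) (f : T -> M) :
  uniq r -> (forall t, f t != 0 -> t \in r) ->
  \sum_(t \in [set: T]) f t = \sum_(t <- r) f t.
Proof.
move=> ur rP; rewrite [RHS]fsbig_seq //; apply/esym/fsbig_widen => // t [_ /=].
by move=> tr; apply/eqP; apply: contra_notT tr => /rP.
Qed.

(* The index sets are choice types: with the classical axioms in force here,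
   every type is one. *)
Record dsum_ob (F : fieldType) (D : lincat F) := DSumOb {
  ix : choiceType;
  smd :> ix -> D }.

Arguments DSumOb {F D} ix smd.

Record dsum_hom (F : fieldType) (D : lincat F) (X Y : dsum_ob D) := DSumHom {
  ent :> forall (s : ix X) (t : ix Y), Mor (X s) (Y t);
  ent_fin : forall s, finite_set [set t | ent s t != 0] }.

Section DirectSumHom.
Variables (F : fieldType) (D : lincat F).
Implicit Types X Y Z : dsum_ob D.

Lemma dsum_homP X Y (f g : dsum_hom X Y) : (forall s t, f s t = g s t) -> f = g.
Proof.
case: f g => [f fP] [g gP] /= e.
have {}e : f = g by apply: functional_extensionality_dep => s;
  apply: functional_extensionality_dep => t.
by rewrite e in fP *; congr DSumHom; apply: Prop_irrelevance.
Qed.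

Lemma ent_seq X Y (f : dsum_hom X Y) s :
  exists2 r : seq (ix Y), uniq r & forall t, f s t != 0 -> t \in r.
Proof.
have /finite_seqP[r rE] := ent_fin f s.
exists (undup r); first exact: undup_uniq.
by move=> t ft; rewrite mem_undup; have : [set` r] t by rewrite -rE.
Qed.

Section Module.
Variables X Y : dsum_ob D.
Local Notation H := (dsum_hom X Y).

HB.instance Definition _ := gen_eqMixin H.
HB.instance Definition _ := gen_choiceMixin H.

Fact zero_fin (s : ix X) :
  finite_set [set t | (0 : Mor (X s) (Y t)) != 0].
Proof.
by apply: sub_finite_set (finite_set0 _) => t /=; rewrite eqxx.
Qed.

Fact add_fin (f g : H) s : finite_set [set t | f s t + g s t != 0].
Proof.
apply: sub_finite_set (_ : finite_set ([set t | f s t != 0] `|` [set t | g s t != 0])).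
  move=> t /=; apply: contraPP => /not_orP[] /negP/negPn/eqP -> /negP/negPn/eqP ->.
  by rewrite addr0 eqxx.
by rewrite finite_setU; split; apply: ent_fin.
Qed.

Fact opp_fin (f : H) s : finite_set [set t | - f s t != 0].
Proof.
by apply: sub_finite_set (ent_fin f s) => t /=; rewrite oppr_eq0.
Qed.

Fact scale_fin (a : F) (f : H) s : finite_set [set t | a *: f s t != 0].
Proof.
by apply: sub_finite_set (ent_fin f s) => t /=; apply: contraNN => /eqP ->;
  rewrite scaler0.
Qed.

Definition dzero : H := DSumHom zero_fin.
Definition dadd (f g : H) : H := DSumHom (add_fin f g).
Definition dopp (f : H) : H := DSumHom (opp_fin f).
Definition dscale (a : F) (f : H) : H := DSumHom (scale_fin a f).

Fact daddA : associative dadd.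
Proof. by move=> f g h; apply: dsum_homP => s t; apply: addrA. Qed.
Fact daddC : commutative dadd.
Proof. by move=> f g; apply: dsum_homP => s t; apply: addrC. Qed.
Fact dadd0 : left_id dzero dadd.
Proof. by move=> f; apply: dsum_homP => s t; apply: add0r. Qed.
Fact daddN : left_inverse dzero dopp dadd.
Proof. by move=> f; apply: dsum_homP => s t; apply: addNr. Qed.

HB.instance Definition _ := GRing.isZmodule.Build H daddA daddC dadd0 daddN.

Fact dscaleA a b (f : H) : dscale a (dscale b f) = dscale (a * b) f.
Proof. by apply: dsum_homP => s t; apply: scalerA. Qed.
Fact dscale1 : left_id 1 dscale.
Proof. by move=> f; apply: dsum_homP => s t; apply: scale1r. Qed.
Fact dscaleDr : right_distributive dscale +%R.
Proof. by move=> a f g; apply: dsum_homP => s t; apply: scalerDr. Qed.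
Fact dscaleDl (f : H) : {morph dscale^~ f : a b / a + b}.
Proof. by move=> a b; apply: dsum_homP => s t; apply: scalerDl. Qed.

HB.instance Definition _ :=
  GRing.Zmodule_isLmodule.Build F H dscaleA dscale1 dscaleDr dscaleDl.

End Module.

Definition dhom X Y : lmodType F := dsum_hom X Y.

Fact dcomp_fin X Y Z (g : dsum_hom Y Z) (f : dsum_hom X Y) s :
  finite_set [set u | \sum_(t \in [set: ix Y]) (g t u ∘ f s t) != 0].
Proof.
have fin : finite_set (\bigcup_(t in [set t | f s t != 0]) [set u | g t u != 0]).
  by apply: bigcup_finite => [|t _]; apply: ent_fin.
apply: sub_finite_set fin => u /=; apply: contraPP => nu.
apply/negP/negPn/eqP; apply: fsbig1 => t _.
have [->|fn] := eqVneq (f s t) 0; first exact: compm0.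
have [->|gn] := eqVneq (g t u) 0; first exact: comp0m.
by case: nu; exists t.
Qed.

Definition dcomp X Y Z (g : dhom Y Z) (f : dhom X Y) : dhom X Z :=
  DSumHom (dcomp_fin g f).

Section Diagonal.
Variables (X Y : dsum_ob D) (phi : ix X -> ix Y).
Variable f : forall s, Mor (X s) (Y (phi s)).

Definition dmap_ent s t : Mor (X s) (Y t) :=
  match phi s =P t with
  | ReflectT e => ecast t (Mor (X s) (Y t)) e (f s)
  | ReflectF _ => 0
  end.

Lemma dmap_entE s : dmap_ent s (phi s) = f s.
Proof.
rewrite /dmap_ent; case: eqP => // e.
by rewrite (eq_irrelevance e (erefl _)).
Qed.

Lemma dmap_ent0 s t : phi s <> t -> dmap_ent s t = 0.
Proof. by rewrite /dmap_ent; case: eqP. Qed.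

Fact dmap_fin s : finite_set [set t | dmap_ent s t != 0].
Proof.
apply: sub_finite_set (finite_set1 (phi s)) => t /=.
by have [->|/dmap_ent0 ->] := phi s =P t; rewrite ?eqxx.
Qed.

Definition dmap : dhom X Y := DSumHom dmap_fin.

End Diagonal.

Definition did X : dhom X X := dmap (phi := id) (fun s => idm (X s)).

Lemma dcomp_mapr X Y Z (phi : ix X -> ix Y) (f : forall s, Mor (X s) (Y (phi s)))
    (g : dhom Y Z) s u :
  dcomp g (dmap f) s u = g (phi s) u ∘ f s.
Proof.
rewrite /= (@fsum_seq _ _ [:: phi s]) //.
  by rewrite big_seq1 dmap_entE.
move=> t; rewrite inE; have [->|tn] := phi s =P t; first by rewrite eqxx.
by rewrite dmap_ent0 // compm0 eqxx.
Qed.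

Lemma dcomp_mapl X Y Z (phi : ix Y -> ix Z) (g : forall t, Mor (Y t) (Z (phi t)))
    (f : dhom X Y) s t :
  injective phi -> dcomp (dmap g) f s (phi t) = g t ∘ f s t.
Proof.
move=> phi_inj; rewrite /= (@fsum_seq _ _ [:: t]) //.
  by rewrite big_seq1 dmap_entE.
move=> t'; rewrite inE; have [->|tn] := t' =P t; first by [].
by rewrite dmap_ent0 ?comp0m ?eqxx // => /phi_inj.
Qed.

Lemma dcomp_map X Y Z (phi : ix X -> ix Y) (psi : ix Y -> ix Z)
    (f : forall s, Mor (X s) (Y (phi s))) (g : forall t, Mor (Y t) (Z (psi t))) :
  dcomp (dmap g) (dmap f) =
  dmap (phi := psi \o phi) (fun s => g (phi s) ∘ f s).
Proof.
apply: dsum_homP => s u; rewrite dcomp_mapr /=.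
have [<-|e] := psi (phi s) =P u.
  by rewrite dmap_entE (dmap_entE (phi := psi \o phi)).
by rewrite dmap_ent0 // comp0m (dmap_ent0 (phi := psi \o phi)).
Qed.

Lemma eq_dmap X Y (phi : ix X -> ix Y) (f g : forall s, Mor (X s) (Y (phi s))) :
  (forall s, f s = g s) -> dmap f = dmap g.
Proof.
by move=> e; congr dmap; apply: functional_extensionality_dep.
Qed.

Lemma eq_dmap_at X Y (phi psi : ix X -> ix Y)
    (f : forall s, Mor (X s) (Y (phi s))) (g : forall s, Mor (X s) (Y (psi s)))
    s t (e : phi s = psi s) :
  ecast u (Mor (X s) (Y u)) e (f s) = g s -> dmap f s t = dmap g s t.
Proof.
move=> E; rewrite /= /dmap_ent -E; move: (f s) (psi s) e {E} => h v e.
by case: v / e.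
Qed.

Fact dcompA X Y Z W (h : dhom Z W) (g : dhom Y Z) (f : dhom X Y) :
  dcomp h (dcomp g f) = dcomp (dcomp h g) f.
Proof.
apply: dsum_homP => s v /=.
have [r ur rP] := ent_seq f s.
have [R uR RP] : exists2 R : seq (ix Z), uniq R &
    forall t u, t \in r -> g t u != 0 -> u \in R.
  elim: r {ur rP} => [|t r [R uR RP]]; first by exists [::].
  have [R' uR' RP'] := ent_seq g t.
  exists (undup (R' ++ R)); first exact: undup_uniq.
  move=> t' u; rewrite inE mem_undup mem_cat => /orP[/eqP ->|tr] gn.
    by rewrite RP'.
  by rewrite (RP t') ?orbT.
have sumf (V : D) (k : forall t, Mor (Y t) V) :
    \sum_(t \in [set: ix Y]) (k t ∘ f s t) = \sum_(t <- r) (k t ∘ f s t).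
  apply: fsum_seq => // t; apply: contraNT => tr; apply/eqP.
  have [->|fn] := eqVneq (f s t) 0; first exact: compm0.
  by rewrite rP in tr.
rewrite sumf (@fsum_seq _ _ R) //; last first.
  move=> u; apply: contraNT => uR'; rewrite sumf big1_seq ?compm0 // => t /= tr.
  have [->|gn] := eqVneq (g t u) 0; first exact: comp0m.
  by rewrite (RP t u) in uR'.
under eq_bigr do rewrite sumf comp_sumr.
rewrite exchange_big /=; apply: eq_big_seq => t tr.
rewrite (@fsum_seq _ _ R) //; last first.
  move=> u; apply: contraNT => uR'.
  have [->|gn] := eqVneq (g t u) 0; first by rewrite compm0.
  by rewrite (RP t u) in uR'.
by rewrite comp_suml; apply: eq_bigr => u _; rewrite compA.
Qed.

Fact dcomp1m X Y (f : dhom X Y) : dcomp (did Y) f = f.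
Proof.
by apply: dsum_homP => s t; rewrite (dcomp_mapl (phi := id)) // comp1m.
Qed.

Fact dcompm1 X Y (f : dhom X Y) : dcomp f (did X) = f.
Proof. by apply: dsum_homP => s t; rewrite dcomp_mapr compm1. Qed.

Fact dcomp_linl X Y Z a (g1 g2 : dhom Y Z) (f : dhom X Y) :
  dcomp (a *: g1 + g2) f = a *: dcomp g1 f + dcomp g2 f.
Proof.
apply: dsum_homP => s u /=; have [r ur rP] := ent_seq f s.
have sumf (k : forall t, Mor (Y t) (Z u)) :
    \sum_(t \in [set: ix Y]) (k t ∘ f s t) = \sum_(t <- r) (k t ∘ f s t).
  apply: fsum_seq => // t; apply: contraNT => tr; apply/eqP.
  have [->|fn] := eqVneq (f s t) 0; first exact: compm0.
  by rewrite rP in tr.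
rewrite !sumf scaler_sumr -big_split; apply: eq_bigr => t _.
exact: comp_linl.
Qed.

Fact dcomp_linr X Y Z a (g : dhom Y Z) (f1 f2 : dhom X Y) :
  dcomp g (a *: f1 + f2) = a *: dcomp g f1 + dcomp g f2.
Proof.
apply: dsum_homP => s u /=.
have [r1 _ r1P] := ent_seq f1 s; have [r2 _ r2P] := ent_seq f2 s.
pose r := undup (r1 ++ r2).
have sumf (k : forall t, Mor (X s) (Y t)) :
    (forall t, t \notin r -> k t = 0) ->
    \sum_(t \in [set: ix Y]) (g t u ∘ k t) = \sum_(t <- r) (g t u ∘ k t).
  move=> k0; apply: fsum_seq => [|t]; first exact: undup_uniq.
  by apply: contraNT => /k0 ->; rewrite compm0.
have f10 t : t \notin r -> f1 s t = 0.
  rewrite mem_undup mem_cat; apply: contraNeq => fn.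
  by rewrite r1P.
have f20 t : t \notin r -> f2 s t = 0.
  rewrite mem_undup mem_cat; apply: contraNeq => fn.
  by rewrite r2P ?orbT.
rewrite !sumf //; last by move=> t tr; rewrite /= f10 // f20 // scaler0 addr0.
rewrite scaler_sumr -big_split; apply: eq_bigr => t _.
exact: comp_linr.
Qed.

Definition dsum_lincat : lincat F :=
  @LinCat F (dsum_ob D) dhom did dcomp dcompA dcomp1m dcompm1 dcomp_linl
    dcomp_linr.

End DirectSumHom.

Section DirectSumTensor.
Variables (F : fieldType) (D : moncat F).
Local Notation DS := (dsum_lincat D).
Implicit Types X Y Z : DS.

Definition dtens_ob (X Y : DS) : DS :=
  DSumOb (ix X * ix Y)%type (fun p => X p.1 ⊗ Y p.2).

Lemma tens0m (X Y X' Y' : D) (g : Mor Y Y') : (0 : Mor X X') ⊗ₘ g = 0.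
Proof.
have := bmor_linl tens 1 (0 : Mor X X') 0 g; rewrite !scale1r addr0 => e.
by apply: (addrI ((0 : Mor X X') ⊗ₘ g)); rewrite -e addr0.
Qed.

Lemma tensm0 (X Y X' Y' : D) (f : Mor X X') : f ⊗ₘ (0 : Mor Y Y') = 0.
Proof.
have := bmor_linr tens 1 f (0 : Mor Y Y') 0; rewrite !scale1r addr0 => e.
by apply: (addrI (f ⊗ₘ (0 : Mor Y Y'))); rewrite -e addr0.
Qed.

Lemma tens_suml (X Y X' Y' : D) (J : Type) (r : seq J)
    (f : J -> Mor X X') (g : Mor Y Y') :
  (\sum_(j <- r) f j) ⊗ₘ g = \sum_(j <- r) (f j ⊗ₘ g).
Proof.
apply: (big_morph (fun f => f ⊗ₘ g)) => [f1 f2|]; last exact: tens0m.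
by have := bmor_linl tens 1 f1 f2 g; rewrite !scale1r.
Qed.

Lemma tens_sumr (X Y X' Y' : D) (J : Type) (r : seq J)
    (f : Mor X X') (g : J -> Mor Y Y') :
  f ⊗ₘ (\sum_(j <- r) g j) = \sum_(j <- r) (f ⊗ₘ g j).
Proof.
apply: (big_morph (fun g => f ⊗ₘ g)) => [g1 g2|]; last exact: tensm0.
by have := bmor_linr tens 1 f g1 g2; rewrite !scale1r.
Qed.

Section TensorMorphism.
Variables (X X' Y Y' : DS) (f : Mor X X') (g : Mor Y Y').

Definition dtens_ent (p : ix (dtens_ob X Y)) (q : ix (dtens_ob X' Y')) :
    Mor (dtens_ob X Y p) (dtens_ob X' Y' q) :=
  ent f p.1 q.1 ⊗ₘ ent g p.2 q.2.

Fact dtens_fin p : finite_set [set q | dtens_ent p q != 0].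
Proof.
have fin : finite_set ([set t | ent f p.1 t != 0] `*` [set t | ent g p.2 t != 0]).
  by apply: finite_setX; apply: ent_fin.
apply: sub_finite_set fin => -[t t'] /=; rewrite /dtens_ent /=.
have [->|fn] := eqVneq (ent f p.1 t) 0; first by rewrite tens0m eqxx.
have [->|gn] := eqVneq (ent g p.2 t') 0; first by rewrite tensm0 eqxx.
by [].
Qed.

Definition dtens_mor : Mor (dtens_ob X Y) (dtens_ob X' Y') := DSumHom dtens_fin.

End TensorMorphism.

Lemma dtens_map (X X' Y Y' : DS) (phi : ix X -> ix X') (psi : ix Y -> ix Y')
    (f : forall s, Mor (X s) (X' (phi s))) (g : forall s, Mor (Y s) (Y' (psi s))) :
  dtens_mor (dmap f : Mor X X') (dmap g : Mor Y Y') =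
  dmap (X := dtens_ob X Y) (Y := dtens_ob X' Y')
    (phi := fun p => (phi p.1, psi p.2)) (fun p => f p.1 ⊗ₘ g p.2).
Proof.
apply: dsum_homP => -[s s'] [t t'].
have [[<- <-]|e] := (phi s, psi s') =P (t, t').
  rewrite [RHS](dmap_entE (X := dtens_ob X Y) (Y := dtens_ob X' Y')
    (phi := fun p => (phi p.1, psi p.2)) _ (s, s')) /=.
  by rewrite /dtens_ent /= !dmap_entE.
rewrite [RHS]dmap_ent0 //= /dtens_ent /=.
have [e1|e1] := phi s =P t; last by rewrite (dmap_ent0 _ e1) tens0m.
have [e2|e2] := psi s' =P t'; last by rewrite (dmap_ent0 _ e2) tensm0.
by case: e; rewrite e1 e2.
Qed.

Fact dtens_id X Y : dtens_mor (idm X) (idm Y) = idm (dtens_ob X Y).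
Proof.
rewrite [LHS]dtens_map; apply: dsum_homP => -[s s'] [t t'].
have [[<- <-]|n] := (s, s') =P (t, t'); last by rewrite [RHS]dmap_ent0 ?[LHS]dmap_ent0.
rewrite [RHS](dmap_entE (X := dtens_ob X Y) (phi := id)).
rewrite [LHS](dmap_entE (X := dtens_ob X Y) (Y := dtens_ob X Y)
  (phi := fun p => (p.1, p.2)) _ (s, s')) /=.
exact: bmor_id.
Qed.

Fact dtens_comp (X X' X'' Y Y' Y'' : DS) (f' : Mor X' X'') (f : Mor X X')
    (g' : Mor Y' Y'') (g : Mor Y Y') :
  dtens_mor (f' ∘ f) (g' ∘ g) = dtens_mor f' g' ∘ dtens_mor f g.
Proof.
apply: dsum_homP => -[s s'] [u u']; rewrite /= /dtens_ent /=.
have [r ur rP] := ent_seq f s; have [r' ur' rP'] := ent_seq g s'.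
rewrite (@fsum_seq _ _ r) //; last first.
  move=> t; apply: contraNT => tr; have [->|fn] := eqVneq (ent f s t) 0.
    by rewrite compm0.
  by rewrite rP in tr.
rewrite (@fsum_seq _ _ r') //; last first.
  move=> t; apply: contraNT => tr; have [->|gn] := eqVneq (ent g s' t) 0.
    by rewrite compm0.
  by rewrite rP' in tr.
rewrite (@fsum_seq _ _ [seq (t, t') | t <- r, t' <- r']); last first.
- move=> [t t'] /=; apply: contraNT => tr; apply/eqP.
  have [->|fn] := eqVneq (ent f s t) 0; first by rewrite tens0m compm0.
  have [->|gn] := eqVneq (ent g s' t') 0; first by rewrite tensm0 compm0.
  by case/negP: tr; apply/allpairsP; exists (t, t'); rewrite rP ?rP'.
- by apply: allpairs_uniq => // -[? ?] [? ?] _ _ [-> ->].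
rewrite big_allpairs tens_suml; apply: eq_bigr => t _.
rewrite tens_sumr; apply: eq_bigr => t' _ /=.
by rewrite bmor_comp.
Qed.

Fact dtens_linl (X X' Y Y' : DS) a (f g : Mor X X') (h : Mor Y Y') :
  dtens_mor (a *: f + g) h = a *: dtens_mor f h + dtens_mor g h.
Proof. by apply: dsum_homP => p q; apply: bmor_linl. Qed.

Fact dtens_linr (X X' Y Y' : DS) a (h : Mor X X') (f g : Mor Y Y') :
  dtens_mor h (a *: f + g) = a *: dtens_mor h f + dtens_mor h g.
Proof. by apply: dsum_homP => p q; apply: bmor_linr. Qed.

Definition dtens : bilfun DS DS DS :=
  BilFun dtens_id dtens_comp dtens_linl dtens_linr.

Definition dsingle (X : D) : DS := DSumOb unit (fun _ => X).

Section DiagonalIso.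
Variables (X Y : DS) (phi : ix X -> ix Y) (psi : ix Y -> ix X).
Hypotheses (phiK : cancel phi psi) (psiK : cancel psi phi).
Variables (f : forall s, iso (X s) (Y (phi s))).

Definition dmap_inv_ent t : Mor (Y t) (X (psi t)) :=
  ecast u (Mor (Y u) (X (psi t))) (psiK t) (bwd (f (psi t))).

Fact dmap_invK :
  (dmap (phi := psi) dmap_inv_ent : Mor Y X) ∘ (dmap f : Mor X Y) = idm X.
Proof.
rewrite [LHS]dcomp_map; apply: dsum_homP => s u /=.
have E : dmap_inv_ent (phi s) ∘ f s =
    ecast u (Mor (X s) (X u)) (esym (phiK s)) (idm (X s)).
  rewrite /dmap_inv_ent; move: (psiK (phi s)) (esym (phiK s)).
  move: (psi (phi s)) => s' e' e; case: s' / e e' => e'.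
  by rewrite (eq_irrelevance e' (erefl _)) /= bwdK.
have [<-|n] := s =P u.
  rewrite [RHS](dmap_entE (phi := id)).
  rewrite /dmap_ent /=; case: (psi (phi s) =P s) => [e|]; last by rewrite phiK.
  rewrite E; move: (esym (phiK s)) e; move: (psi (phi s)) => s' e1.
  by case: s' / e1 => e2; rewrite (eq_irrelevance e2 (erefl _)).
rewrite [RHS]dmap_ent0 // dmap_ent0 //=; rewrite phiK; exact: n.
Qed.

Fact dmap_Kinv :
  (dmap f : Mor X Y) ∘ (dmap (phi := psi) dmap_inv_ent : Mor Y X) = idm Y.
Proof.
rewrite [LHS]dcomp_map; apply: dsum_homP => s u /=.
have E : f (psi s) ∘ dmap_inv_ent s =
    ecast u (Mor (Y s) (Y u)) (esym (psiK s)) (idm (Y s)).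
  have gen u' (e : phi (psi s) = u') :
      f (psi s) ∘ ecast u (Mor (Y u) (X (psi s))) e (bwd (f (psi s))) =
      ecast u (Mor (Y u') (Y u)) (esym e) (idm (Y u')).
    by case: u' / e; rewrite /= fwdK.
  exact: gen.
have [<-|n] := s =P u.
  rewrite [RHS](dmap_entE (phi := id)).
  rewrite /dmap_ent /=; case: (phi (psi s) =P s) => [e|]; last by rewrite psiK.
  rewrite E; move: (esym (psiK s)) e; move: (phi (psi s)) => s' e1.
  by case: s' / e1 => e2; rewrite (eq_irrelevance e2 (erefl _)).
rewrite [RHS]dmap_ent0 // dmap_ent0 //=; rewrite psiK; exact: n.
Qed.

Definition dmap_iso : iso X Y := Iso dmap_invK dmap_Kinv.

End DiagonalIso.

Definition dlun X : iso (dtens (dsingle 𝟙) X) X :=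
  @dmap_iso (dtens (dsingle 𝟙) X) X (fun p => p.2) (fun s => (tt, s))
    (fun p => let: (tt, s) := p in erefl) (fun s => erefl) (fun p => lun (X p.2)).

Definition drun X : iso (dtens X (dsingle 𝟙)) X :=
  @dmap_iso (dtens X (dsingle 𝟙)) X (fun p => p.1) (fun s => (s, tt))
    (fun p => let: (s, tt) := p in erefl) (fun s => erefl) (fun p => run (X p.1)).

Definition dassoc X Y Z : iso (dtens X (dtens Y Z)) (dtens (dtens X Y) Z) :=
  @dmap_iso (dtens X (dtens Y Z)) (dtens (dtens X Y) Z)
    (fun p => ((p.1, p.2.1), p.2.2)) (fun p => (p.1.1, (p.1.2, p.2)))
    (fun p => let: (s, (t, u)) := p in erefl)
    (fun p => let: ((s, t), u) := p in erefl)
    (fun p => assoc (X p.1) (Y p.2.1) (Z p.2.2)).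

Fact dlun_nat X Y (f : Mor X Y) :
  dlun Y ∘ bmor dtens (idm (dsingle 𝟙)) f = f ∘ dlun X.
Proof.
apply: dsum_homP => -[[] s] t.
rewrite [RHS](dcomp_mapr (X := dtens (dsingle 𝟙) X)).
have inj : injective (fun p : unit * ix Y => p.2) by move=> [[] ?] [[] ?] /= ->.
apply: (etrans (dcomp_mapl (Y := dtens (dsingle 𝟙) Y) _ _ _ (tt, t) inj) _).
rewrite /= /dtens_ent /= -lun_nat; congr (_ ∘ (_ ⊗ₘ _)).
exact: (dmap_entE (X := dsingle 𝟙) (phi := id)).
Qed.

Fact drun_nat X Y (f : Mor X Y) :
  drun Y ∘ bmor dtens f (idm (dsingle 𝟙)) = f ∘ drun X.
Proof.
apply: dsum_homP => -[s []] t.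
rewrite [RHS](dcomp_mapr (X := dtens X (dsingle 𝟙))).
have inj : injective (fun p : ix Y * unit => p.1) by move=> [? []] [? []] /= ->.
apply: (etrans (dcomp_mapl (Y := dtens Y (dsingle 𝟙)) _ _ _ (t, tt) inj) _).
rewrite /= /dtens_ent /= -run_nat; congr (_ ∘ (_ ⊗ₘ _)).
exact: (dmap_entE (X := dsingle 𝟙) (phi := id)).
Qed.

Fact dassoc_nat X X' Y Y' Z Z' (f : Mor X X') (g : Mor Y Y') (h : Mor Z Z') :
  dassoc X' Y' Z' ∘ bmor dtens f (bmor dtens g h) =
  bmor dtens (bmor dtens f g) h ∘ dassoc X Y Z.
Proof.
apply: dsum_homP => -[s [t u]] [[s' t'] u'].
rewrite [RHS](dcomp_mapr (X := dtens X (dtens Y Z))).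
have inj : injective (fun p : ix X' * (ix Y' * ix Z') => ((p.1, p.2.1), p.2.2)).
  by move=> [? [? ?]] [? [? ?]] /= [-> -> ->].
apply: (etrans (dcomp_mapl (X := dtens X (dtens Y Z))
  (Y := dtens X' (dtens Y' Z')) (Z := dtens (dtens X' Y') Z')
  (phi := fun p => ((p.1, p.2.1), p.2.2))
  (fun p => assoc (X' p.1) (Y' p.2.1) (Z' p.2.2))
  (bmor dtens f (bmor dtens g h)) (s, (t, u)) (s', (t', u')) inj) _).
exact: assoc_nat.
Qed.

Fact dtriangle X Y :
  bmor dtens (drun X) (idm Y) ∘ dassoc X (dsingle 𝟙) Y =
  bmor dtens (idm X) (dlun Y).
Proof.
rewrite /= !dtens_map [LHS]dcomp_map.
by apply: eq_dmap => -[s [? t]]; apply: triangle.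
Qed.

Fact dpentagon X Y Z W :
  dassoc (dtens X Y) Z W ∘ dassoc X Y (dtens Z W) =
  bmor dtens (dassoc X Y Z) (idm W) ∘ dassoc X (dtens Y Z) W ∘
    bmor dtens (idm X) (dassoc Y Z W).
Proof.
rewrite /= !dtens_map !dcomp_map.
by apply: eq_dmap => -[s [t [u v]]]; apply: pentagon.
Qed.

Definition dsum_moncat : moncat F :=
  @MonCat F DS dtens (dsingle 𝟙) dlun drun dassoc dlun_nat drun_nat dassoc_nat
    dtriangle dpentagon.

End DirectSumTensor.

Section DirectSumBraiding.
Variables (F : fieldType) (D : brcat F).
Local Notation DS := (dsum_moncat D).
Implicit Types X Y Z : DS.

Definition dbraid X Y : iso (X ⊗ Y) (Y ⊗ X) :=
  @dmap_iso _ D (X ⊗ Y) (Y ⊗ X) (fun p => (p.2, p.1)) (fun p => (p.2, p.1))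
    (fun p => let: (s, t) := p in erefl) (fun p => let: (s, t) := p in erefl)
    (fun p => braid (X p.1) (Y p.2)).

Fact dbraid_nat X X' Y Y' (f : Mor X X') (g : Mor Y Y') :
  dbraid X' Y' ∘ (f ⊗ₘ g) = (g ⊗ₘ f) ∘ dbraid X Y.
Proof.
apply: dsum_homP => -[s t] [t' s'].
rewrite [RHS](dcomp_mapr (X := X ⊗ Y)).
have inj : injective (fun p : ix X' * ix Y' => (p.2, p.1)).
  by move=> [? ?] [? ?] /= [-> ->].
apply: (etrans (dcomp_mapl (Y := X' ⊗ Y') (Z := Y' ⊗ X') _ _ _ (s', t') inj) _).
exact: braid_nat.
Qed.

Fact dhexagon1 X Y Z :
  dbraid X (Y ⊗ Z) =
  assoc Y Z X ∘ (idm Y ⊗ₘ dbraid X Z) ∘ bwd (assoc Y X Z) ∘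
    (dbraid X Y ⊗ₘ idm Z) ∘ assoc X Y Z :> Mor _ _.
Proof.
rewrite /= !dtens_map.
rewrite !dcomp_map.
apply: dsum_homP => -[s [t u]] v.
refine (@eq_dmap_at _ _ (X ⊗ (Y ⊗ Z)) _ _ _ _ _ (s, (t, u)) v erefl _).
exact: hexagon1.
Qed.

Fact dhexagon2 X Y Z :
  dbraid (X ⊗ Y) Z =
  bwd (assoc Z X Y) ∘ (dbraid X Z ⊗ₘ idm Y) ∘ assoc X Z Y ∘
    (idm X ⊗ₘ dbraid Y Z) ∘ bwd (assoc X Y Z) :> Mor _ _.
Proof.
rewrite /= !dtens_map.
rewrite !dcomp_map.
apply: dsum_homP => -[[s t] u] v.
refine (@eq_dmap_at _ _ (X ⊗ Y ⊗ Z) _ _ _ _ _ ((s, t), u) v erefl _).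
exact: hexagon2.
Qed.

Definition dsum_brcat : brcat F := BrCat dbraid_nat dhexagon1 dhexagon2.

End DirectSumBraiding.

Definition canonical_object (F : fieldType) (C D : brcat F)
    (K : contragredient C) (B : bilfun C (rev_brcat C) D)
    (I : choiceType) (irr : I -> C) : dsum_brcat D :=
  DSumOb I (fun i => B (K (irr i)) (irr i)).

(* Main.v *)
Require Import Defs.
From mathcomp Require Import all_boot all_algebra.
From mathcomp Require Import boolp classical_sets functions cardinality fsbigop.
Import Defs.
Set Implicit Arguments.
Unset Strict Implicit.
Unset Printing Implicit Defensive.
Import GRing.Theory.
Local Open Scope ring_scope.
Local Open Scope cat_scope.

(* [A] is the coend of [X |-> X' ⊠ X], with universal dinatural maps
   [coin X : X' ⊠ X -> A].  The pairings [X' ⊗ X -> 𝟙] determined by [Γ] give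
   natural maps [can X Y : X' ⊗ Y' -> (X ⊗ Y)'] which make [X |-> X'] lax monoidal
   and braided, and the product of [A] is defined by
   [coin X * coin Y = coin (X ⊗ Y) ∘ (can X Y ⊠ id)].  Dinaturality reduces
   associativity, unitality and commutativity to the coherence of [can].

   For the rigid case, two consequences of the universal property of [⊠] suffice:
   nonzero maps from any object to [𝟙 ⊠ 𝟙] split, and the maps
   [P ⊠ Q -> 𝟙 ⊠ 𝟙] are spanned by the [u ⊠ v].  With the duality
   [(X' ⊠ X)^* = X'' ⊠ X'] they show that the only maps between the summands of [A]
   are scalars, and that the unit component of the product is a nondegenerate form.
   A nonzero ideal thus has a nonzero product with some summand in [𝟙' ⊠ 𝟙]; this
   splits, so the ideal contains the unit.  Finally the image of the product of the
   summands of [X] and [Y] is that of [coin (X ⊗ Y)], the sum of the summands of [A]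
   indexed by the simple constituents of [X ⊗ Y], since for [i : Z -> X ⊗ Y] nonzero
   the map [i' ∘ can X Y] is nonzero. *)

(** * Simple objects and Schur's lemma in linear categories *)

Section Linear.
Variables (F : fieldType) (C : lincat F).
Implicit Types X Y Z W : C.

(** Rewrites with an equation between composites at the head of a right-nested composite, the normal
    form produced by [-!compA]. *)
Lemma comp_reassoc X Y Z W (g : Mor Y Z) (f : Mor X Y) (h : Mor X Z) :
  g ∘ f = h -> forall k : Mor W X, g ∘ (f ∘ k) = h ∘ k.
Proof. by move=> <- k; rewrite compA. Qed.

Lemma bwd_fwd_comp X Y Z (f : iso X Y) (g : Mor Z X) : bwd f ∘ (f ∘ g) = g.
Proof. by rewrite compA bwdK comp1m. Qed.

Lemma fwd_bwd_comp X Y Z (f : iso X Y) (g : Mor Z Y) : f ∘ (bwd f ∘ g) = g.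
Proof. by rewrite compA fwdK comp1m. Qed.

Lemma iso_mono_eq X Y Z (f : iso X Y) (g h : Mor Y Z) : g ∘ f = h ∘ f -> g = h.
Proof. by move=> e; rewrite -(compm1 g) -(compm1 h) -(fwdK f) !compA e. Qed.

Lemma compZl X Y Z a (g : Mor Y Z) (f : Mor X Y) : (a *: g) ∘ f = a *: (g ∘ f).
Proof. by have := comp_linl a g 0 f; rewrite addr0 comp0m addr0. Qed.

Lemma compZr X Y Z a (g : Mor Y Z) (f : Mor X Y) : g ∘ (a *: f) = a *: (g ∘ f).
Proof. by have := comp_linr a g f 0; rewrite addr0 compm0 addr0. Qed.

Lemma compBr X Y Z (g : Mor Y Z) (f1 f2 : Mor X Y) :
  g ∘ (f1 - f2) = g ∘ f1 - g ∘ f2.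
Proof. by rewrite -!scaleN1r compDr compZr. Qed.

Definition iso_id X : iso X X := Iso (comp1m (idm X)) (comp1m (idm X)).

Definition iso_comp X Y Z (g : iso Y Z) (f : iso X Y) : iso X Z.
Proof.
exists (g ∘ f) (bwd f ∘ bwd g).
- by rewrite -compA bwd_fwd_comp bwdK.
- by rewrite -compA fwd_bwd_comp fwdK.
Defined.

Lemma isomorphic_sym X Y : isomorphic X Y -> isomorphic Y X.
Proof. by case=> f; exists; apply: iso_sym. Qed.

Lemma isomorphic_trans X Y Z : isomorphic X Y -> isomorphic Y Z -> isomorphic X Z.
Proof. by case=> f [g]; exists; apply: iso_comp g f. Qed.

Lemma is_iso_isomorphic X Y (f : Mor X Y) : is_iso f -> isomorphic X Y.
Proof. by case=> g [gf fg]; exists; exists f g. Qed.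

Lemma is_zero_mor X Y (f : Mor X Y) : is_zero X -> f = 0.
Proof. by move=> X0; rewrite -(compm1 f) X0 compm0. Qed.

Lemma iso_nonzero X Y : isomorphic X Y -> ~ is_zero X -> ~ is_zero Y.
Proof.
move=> [f] X0 Y0; apply: X0; rewrite /is_zero -(bwdK f).
by rewrite (is_zero_mor (bwd f) Y0) comp0m.
Qed.

Lemma split_mono_iso X Y (f : Mor X Y) (g : Mor Y X) :
  mono f -> f ∘ g = idm Y -> is_iso f.
Proof.
move=> fm fg; exists g; split=> //; apply: fm.
by rewrite compA fg comp1m compm1.
Qed.

Hypothesis C_abelian : is_abelian C.

(** Schur's lemma: the kernel of [f] is a proper subobject of [X], hence zero, so [f] is mono and
    the simplicity of [Y] applies. *)
Lemma simple_mor_iso X Y (f : Mor X Y) :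
  simple X -> simple Y -> f <> 0 -> is_iso f.
Proof.
move=> [X0 Xs] [Y0 Ys] f0; have [_ ker _ _ _] := C_abelian.
have [K [k [fk kP]]] := ker _ _ f.
have kmono : mono k.
  move=> W g h e; have [u [_ uU]] : exists! u : Mor W K, k ∘ u = k ∘ h.
    by apply: kP; rewrite compA fk comp0m.
  by rewrite -(uU h erefl) -(uU g e).
case: (Xs _ _ kmono) => [K0|[l [_ kl]]]; last first.
  by case: f0; rewrite -(compm1 f) -kl compA fk comp0m.
have fmono : mono f.
  move=> W g h e; apply/eqP; rewrite -subr_eq0; apply/eqP.
  have [|u [<- _]] := kP W (g - h); first by rewrite compBr e subrr.
  by rewrite (is_zero_mor k K0) comp0m.
by case: (Ys _ _ fmono).
Qed.

Lemma simple_mor0 X Y (f : Mor X Y) :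
  simple X -> simple Y -> ~ isomorphic X Y -> f = 0.
Proof.
move=> Xs Ys nXY; apply: contrapT => f0; apply: nXY.
exact: is_iso_isomorphic (simple_mor_iso Xs Ys f0).
Qed.

Lemma simple_isomorphic X Y : isomorphic X Y -> simple X -> simple Y.
Proof.
move=> XY [X0 Xs]; split; first exact: iso_nonzero XY X0.
case: XY => f Z m mm.
have gm : mono (bwd f ∘ m).
  move=> W g h; rewrite -!compA => e; apply: mm.
  exact: (iso_epi_eq (f := iso_sym f)) e.
case: (Xs _ _ gm) => [|[n [nm mn]]]; [by left|right].
exists (n ∘ bwd f); split; first by rewrite -compA.
apply: (iso_epi_eq (f := iso_sym f)); rewrite /= compm1.
by rewrite !compA in mn *; rewrite mn comp1m.
Qed.

(** Some simple summand of [X] is mapped to [Y] by a nonzero map, hence isomorphically; the inverse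
    provides the section. *)
Lemma nonzero_split_epi X Y (f : Mor X Y) :
  semisimple C -> simple Y -> f <> 0 -> exists g : Mor Y X, f ∘ g = idm Y.
Proof.
move=> Css Ys f0; have [n [S [Ss [i [p [_ _ ip]]]]]] := Css X.
have [k fk] : exists k, f ∘ i k <> 0.
  apply: contrapT => /forallNP H; apply: f0.
  rewrite -(compm1 f) -ip comp_sumr big1 // => k _.
  by rewrite compA (contrapT (H k)) comp0m.
have [g [_ fg]] := simple_mor_iso (Ss k) Ys fk.
by exists (i k ∘ g); rewrite compA.
Qed.

End Linear.

(** * Bilinear bifunctors *)

Section Bilinear.
Variables (F : fieldType) (C1 C2 D : lincat F) (B : bilfun C1 C2 D).
Variables (X1 Y1 : C1) (X2 Y2 : C2).
Implicit Types (f : Mor X1 Y1) (g : Mor X2 Y2).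

Lemma bmor0l g : bmor B (0 : Mor X1 Y1) g = 0.
Proof.
by have := bmor_linl B (-1) (0 : Mor X1 Y1) 0 g; rewrite scaleN1r oppr0 addr0 scaleN1r addNr.
Qed.

Lemma bmor0r f : bmor B f (0 : Mor X2 Y2) = 0.
Proof.
by have := bmor_linr B (-1) f (0 : Mor X2 Y2) 0; rewrite scaleN1r oppr0 addr0 scaleN1r addNr.
Qed.

Lemma bmorZl a f g : bmor B (a *: f) g = a *: bmor B f g.
Proof. by have := bmor_linl B a f 0 g; rewrite bmor0l !addr0. Qed.

Lemma bmorZr a f g : bmor B f (a *: g) = a *: bmor B f g.
Proof. by have := bmor_linr B a f g 0; rewrite bmor0r !addr0. Qed.

Lemma bmorDl f f' g : bmor B (f + f') g = bmor B f g + bmor B f' g.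
Proof. by have := bmor_linl B 1 f f' g; rewrite !scale1r. Qed.

Lemma bmorDr f g g' : bmor B f (g + g') = bmor B f g + bmor B f g'.
Proof. by have := bmor_linr B 1 f g g'; rewrite !scale1r. Qed.

Lemma bmor_suml (J : Type) (r : seq J) (f : J -> Mor X1 Y1) g :
  bmor B (\sum_(j <- r) f j) g = \sum_(j <- r) bmor B (f j) g.
Proof.
by apply: (big_morph (fun f => bmor B f g)) => [f1 f2|]; rewrite (bmorDl, bmor0l).
Qed.

Lemma bmor_sumr (J : Type) (r : seq J) f (g : J -> Mor X2 Y2) :
  bmor B f (\sum_(j <- r) g j) = \sum_(j <- r) bmor B f (g j).
Proof.
by apply: (big_morph (fun g => bmor B f g)) => [f1 f2|]; rewrite (bmorDr, bmor0r).
Qed.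

End Bilinear.

Section BilinearIso.
Variables (F : fieldType) (C1 C2 D : lincat F) (B : bilfun C1 C2 D).

Lemma bmor_compm1 (X1 Y1 Z1 : C1) (X2 : C2) (g : Mor Y1 Z1) (f : Mor X1 Y1) :
  bmor B (g ∘ f) (idm X2) = bmor B g (idm X2) ∘ bmor B f (idm X2).
Proof. by rewrite -bmor_comp comp1m. Qed.

Lemma bmor_comp1m (X1 : C1) (X2 Y2 Z2 : C2) (g : Mor Y2 Z2) (f : Mor X2 Y2) :
  bmor B (idm X1) (g ∘ f) = bmor B (idm X1) g ∘ bmor B (idm X1) f.
Proof. by rewrite -bmor_comp comp1m. Qed.

Definition bmor_iso (X1 Y1 : C1) (X2 Y2 : C2) (f : iso X1 Y1) (g : iso X2 Y2) :
  iso (B X1 X2) (B Y1 Y2).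
Proof.
exists (bmor B f g) (bmor B (bwd f) (bwd g)).
- by rewrite -bmor_comp !bwdK bmor_id.
- by rewrite -bmor_comp !fwdK bmor_id.
Defined.

End BilinearIso.

(** * Decompositions into representatives of the simple objects *)

Section Decomposition.
Variables (F : fieldType) (C : lincat F).
Hypotheses (C_abelian : is_abelian C) (C_schur : schur C).
Hypothesis C_semisimple : semisimple C.
Variables (I : choiceType) (irr : I -> C).
Hypothesis irrP : irr_representatives irr.
Implicit Types X Y Z : C.

Lemma irr_simple i : simple (irr i).
Proof. by case: irrP. Qed.

Lemma irr_mor0 i j (f : Mor (irr i) (irr j)) : i != j -> f = 0.
Proof.
move=> /eqP ij; apply: (simple_mor0 C_abelian); try exact: irr_simple.
by case: irrP => _ inj _ /inj.
Qed.

(** The summands are values of [irr] on the nose, so that equality of indices decides whether there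
    are nonzero maps between them. *)
Record decomp X := Decomp {
  dec_n : nat;
  dec_ix : 'I_dec_n -> I;
  inc : forall k, Mor (irr (dec_ix k)) X;
  prj : forall k, Mor X (irr (dec_ix k));
  decomp_dirsum : is_dirsum inc prj }.

Arguments dec_ix {X} d k : rename.
Arguments inc {X} d k : rename.
Arguments prj {X} d k : rename.

Fact decomp_exists X : inhabited (decomp X).
Proof.
have [n [S [Ss [i [p [pi pi0 ip]]]]]] := C_semisimple X.
case: irrP => _ _ rep.
have [j jP] := choice (fun k => rep (S k) (Ss k)).
pose w k := inhabited_witness (jP k).
exists; exists n j (fun k => i k ∘ bwd (w k)) (fun k => w k ∘ p k); split.
- by move=> k; rewrite -compA (compA (p k)) pi comp1m fwdK.
- by move=> k l kl; rewrite -compA (compA (p l)) pi0 // comp0m compm0.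
- by rewrite -[RHS]ip; apply: eq_bigr => k _; rewrite -compA bwd_fwd_comp.
Qed.

Definition dec X : decomp X := inhabited_witness (decomp_exists X).

Lemma prj_inc X (d : decomp X) k : prj d k ∘ inc d k = idm _.
Proof. by case: (decomp_dirsum d). Qed.

Lemma sum_inc_prj X (d : decomp X) : \sum_k inc d k ∘ prj d k = idm X.
Proof. by case: (decomp_dirsum d). Qed.

(* The element [\sum_k inc k ⊗ prj k] of the direct sum over [j] of
   [Hom(irr j, X) ⊗ Hom(X, irr j)] is dinatural in [X]. *)
Lemma decomp_dinatural X Y (dX : decomp X) (dY : decomp Y) (f : Mor X Y)
    (M : lmodType F) (b : forall j, Mor (irr j) Y -> Mor X (irr j) -> M) :
  (forall j a g g' h, b j (a *: g + g') h = a *: b j g h + b j g' h) ->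
  (forall j a g h h', b j g (a *: h + h') = a *: b j g h + b j g h') ->
  \sum_k b _ (f ∘ inc dX k) (prj dX k) = \sum_l b _ (inc dY l) (prj dY l ∘ f).
Proof.
move=> bl br.
have b0l j h : b j 0 h = 0.
  by have := bl j (-1) 0 0 h; rewrite scaleN1r oppr0 addr0 scaleN1r addNr.
have b0r j g : b j g 0 = 0.
  by have := br j (-1) g 0 0; rewrite scaleN1r oppr0 addr0 scaleN1r addNr.
have bDl j h : {morph (fun g => b j g h) : g g' / g + g'}.
  by move=> g g'; have := bl j 1 g g' h; rewrite !scale1r.
have bDr j g : {morph b j g : h h' / h + h'}.
  by move=> h h'; have := br j 1 g h h'; rewrite !scale1r.
(* By Schur's lemma [s] is zero or a scalar, and a scalar passes from one argument of [b] to the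
   other. *)
have swap i j (g : Mor (irr j) Y) (s : Mor (irr i) (irr j)) (h : Mor X (irr i)) :
    b i (g ∘ s) h = b j g (s ∘ h).
  have [ij|ij] := eqVneq i j; last by rewrite (irr_mor0 s ij) compm0 comp0m b0l b0r.
  case: j / ij g s => g s; have [a ->] := C_schur (irr_simple i) s.
  rewrite compZr compZl compm1 comp1m.
  by have := bl i a g 0 h; have := br i a g h 0; rewrite b0l b0r !addr0 => -> ->.
(* Insert the decomposition of the identity of [Y], move each matrix entry of [f] across [b], and
   collapse the decomposition of the identity of [X]. *)
transitivity (\sum_k \sum_l b _ (inc dY l) (prj dY l ∘ f ∘ inc dX k ∘ prj dX k)).
  apply: eq_bigr => k _.
  rewrite -[in LHS](comp1m f) -(sum_inc_prj dY) !comp_suml.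
  rewrite (big_morph (fun g => b _ g _) (bDl _ _) (b0l _ _)).
  by apply: eq_bigr => l _; rewrite -!compA swap !compA.
rewrite exchange_big; apply: eq_bigr => l _ /=.
rewrite -(big_morph (b _ _) (bDr _ _) (b0r _ _)); congr (b _ _ _).
under eq_bigr do rewrite -compA; by rewrite -comp_sumr sum_inc_prj compm1.
Qed.

End Decomposition.

Arguments dec_ix {F C I irr X} d k : rename.
Arguments inc {F C I irr X} d k : rename.
Arguments prj {F C I irr X} d k : rename.

(** * Coherence in braided tensor categories *)

Section Coherence.
Variables (F : fieldType) (C : moncat F).
Implicit Types X Y Z W : C.
Local Notation Id := (idm _).
Local Notation a := (assoc _ _ _).

Lemma tens_interchange X Y Z W (f : Mor X Y) (g : Mor Z W) :
  (f ⊗ₘ Id) ∘ (Id ⊗ₘ g) = (Id ⊗ₘ g) ∘ (f ⊗ₘ Id).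
Proof. by rewrite -!bmor_comp !comp1m !compm1. Qed.

Lemma assoc_nat1 X X' Y Z (f : Mor X X') :
  ((f ⊗ₘ idm Y) ⊗ₘ idm Z) ∘ a = a ∘ (f ⊗ₘ Id).
Proof. by rewrite -assoc_nat bmor_id. Qed.

Lemma assoc_nat2 X Y Y' Z (f : Mor Y Y') :
  ((idm X ⊗ₘ f) ⊗ₘ idm Z) ∘ a = a ∘ (Id ⊗ₘ (f ⊗ₘ Id)).
Proof. by rewrite -assoc_nat. Qed.

Lemma assoc_nat3 X Y Z Z' (f : Mor Z Z') :
  (Id ⊗ₘ f) ∘ a = assoc X Y Z' ∘ (Id ⊗ₘ (Id ⊗ₘ f)).
Proof. by rewrite assoc_nat bmor_id. Qed.

Lemma pentagon_right X Y Z W :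
  (assoc X Y Z ⊗ₘ idm W) ∘ (a ∘ (Id ⊗ₘ assoc Y Z W)) = a ∘ a.
Proof. by rewrite pentagon compA. Qed.

Lemma pentagon_bwd X Y Z W :
  (bwd (assoc X Y Z) ⊗ₘ idm W) ∘ assoc (X ⊗ Y) Z W =
  a ∘ (Id ⊗ₘ a) ∘ bwd (assoc X Y (Z ⊗ W)).
Proof.
apply: (iso_mono_eq (f := assoc X Y (Z ⊗ W))).
rewrite -!compA bwdK compm1 pentagon -!compA.
by rewrite (comp_reassoc (h := Id)) ?comp1m // -bmor_compm1 bwdK bmor_id.
Qed.

Lemma pentagon_fwd X Y Z W :
  (assoc X Y Z ⊗ₘ idm W) ∘ assoc X (Y ⊗ Z) W =
  a ∘ a ∘ (Id ⊗ₘ bwd (assoc Y Z W)).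
Proof.
by rewrite pentagon -!compA -bmor_comp1m fwdK bmor_id compm1.
Qed.

Lemma lun_faithful X Y (f g : Mor X Y) :
  idm 𝟙 ⊗ₘ f = idm 𝟙 ⊗ₘ g -> f = g.
Proof. by move=> e; apply: (iso_mono_eq (f := lun X)); rewrite -!lun_nat e. Qed.

Lemma run_faithful X Y (f g : Mor X Y) :
  f ⊗ₘ idm 𝟙 = g ⊗ₘ idm 𝟙 -> f = g.
Proof. by move=> e; apply: (iso_mono_eq (f := run X)); rewrite -!run_nat e. Qed.

(** Kelly's argument: tensoring with [𝟙] is faithful, and after it the claim follows from the
    pentagon on [𝟙, 𝟙, X, Y] and the triangle. *)
Lemma lun_tens X Y : (lun X ⊗ₘ idm Y) ∘ assoc 𝟙 X Y = lun (X ⊗ Y).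
Proof.
apply: lun_faithful; apply: (iso_epi_eq (f := assoc 𝟙 X Y)).
rewrite bmor_comp1m -(triangle 𝟙 (X ⊗ Y)) [RHS]compA -assoc_nat1 -compA pentagon.
rewrite -!compA [RHS]compA -bmor_compm1 triangle.
by rewrite (comp_reassoc (assoc_nat2 _ _ _)) -compA.
Qed.

(** After tensoring with [𝟙], the two sides are compared by naturality of [lun] at the map [lun 𝟙]
    itself. *)
Lemma lun_run_one : lun 𝟙 = run 𝟙 :> Mor (𝟙 ⊗ 𝟙 : C) 𝟙.
Proof.
apply: run_faithful; apply: (iso_mono_eq (f := assoc 𝟙 𝟙 𝟙)).
rewrite lun_tens triangle.
by apply: (iso_epi_eq (f := lun 𝟙)); rewrite lun_nat.
Qed.

End Coherence.

Section BraidUnit.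
Variables (F : fieldType) (C : brcat F).

(** Naturality of the braiding at [lun 𝟙] and the hexagon on [X, 𝟙, 𝟙] give the identity up to an
    invertible factor, which cancels. *)
Lemma lun_braid (X : C) : lun X ∘ braid X 𝟙 = run X.
Proof.
apply: run_faithful; apply: (iso_mono_eq (f := assoc X 𝟙 𝟙)).
apply: (iso_epi_eq (f := iso_comp (lun X) (braid X 𝟙))) => /=.
rewrite triangle; apply: esym; rewrite -[LHS]compA braid_nat hexagon1 lun_run_one -!compA.
rewrite (comp_reassoc (triangle _ _)) bmor_compm1 -!compA.
rewrite (comp_reassoc (esym (bmor_comp1m _ _ _ _))).
by rewrite (comp_reassoc (lun_nat _)) -!lun_tens -!compA fwd_bwd_comp.
Qed.

End BraidUnit.

Lemma run_braid (F : fieldType) (C : brcat F) (X : C) : run X ∘ braid 𝟙 X = lun X.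
Proof. by have := lun_braid (X : rev_brcat C) => /= <-; rewrite -compA bwdK compm1. Qed.

(** * The braiding on right-nested words *)

Section Hat.
Variables (F : fieldType) (C : brcat F).
Implicit Types X Y Z W V : C.
Local Notation Id := (idm _).
Local Notation a := (assoc _ _ _).

(* Coherence is tamed by letting all morphisms act on right-nested words
   [X ⊗ (Y ⊗ W)], naturally in [W]: [swap] is the braiding in this form. *)
Definition swap X Y W : Mor (X ⊗ (Y ⊗ W)) (Y ⊗ (X ⊗ W)) :=
  locked (bwd (assoc Y X W) ∘ (braid X Y ⊗ₘ Id) ∘ assoc X Y W).

Lemma swapE X Y W :
  swap X Y W = bwd (assoc Y X W) ∘ (braid X Y ⊗ₘ Id) ∘ assoc X Y W.
Proof. by rewrite /swap -lock. Qed.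

Lemma assoc_swap X Y W : assoc Y X W ∘ swap X Y W = (braid X Y ⊗ₘ Id) ∘ assoc X Y W.
Proof. by rewrite swapE -!compA fwd_bwd_comp. Qed.

Lemma swap_nat X X' Y Y' W W' (f : Mor X X') (g : Mor Y Y') (h : Mor W W') :
  swap X' Y' W' ∘ (f ⊗ₘ (g ⊗ₘ h)) = (g ⊗ₘ (f ⊗ₘ h)) ∘ swap X Y W.
Proof.
apply: (iso_epi_eq (f := assoc Y' X' W')).
rewrite compA assoc_swap -compA assoc_nat [RHS]compA assoc_nat -[RHS]compA assoc_swap.
by rewrite !compA -!bmor_comp comp1m compm1 braid_nat.
Qed.

Lemma swap_nat1 X X' Y W (f : Mor X X') :
  swap X' Y W ∘ (f ⊗ₘ Id) = (Id ⊗ₘ (f ⊗ₘ Id)) ∘ swap X Y W.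
Proof. by rewrite -swap_nat bmor_id. Qed.

Lemma swap_nat2 X Y Y' W (g : Mor Y Y') :
  swap X Y' W ∘ (Id ⊗ₘ (g ⊗ₘ Id)) = (g ⊗ₘ Id) ∘ swap X Y W.
Proof. by rewrite swap_nat bmor_id. Qed.

Lemma swap_nat3 X Y W W' (h : Mor W W') :
  swap X Y W' ∘ (Id ⊗ₘ (Id ⊗ₘ h)) = (Id ⊗ₘ (Id ⊗ₘ h)) ∘ swap X Y W.
Proof. exact: swap_nat. Qed.

(** The second hexagon on right-nested words: its associators are absorbed by pentagons. *)
Lemma swap_tensl X Y Z W : swap (X ⊗ Y) Z W ∘ a =
  (Id ⊗ₘ a) ∘ swap X Z (Y ⊗ W) ∘ (Id ⊗ₘ swap Y Z W).
Proof.
rewrite !swapE hexagon2 !bmor_compm1 !bmor_comp1m -!compA.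
rewrite (comp_reassoc (pentagon_bwd _ _ _ _)) -!compA bwdK compm1.
rewrite (comp_reassoc (assoc_nat2 _ _ _)) -!compA.
rewrite (comp_reassoc (pentagon_fwd _ _ _ _)) -!compA.
rewrite (comp_reassoc (assoc_nat1 _ _ _)) -!compA.
by rewrite (comp_reassoc (pentagon_bwd _ _ _ _)) -!compA bwd_fwd_comp.
Qed.

Lemma swap_tensr X Y Z W : swap X (Y ⊗ Z) W ∘ (Id ⊗ₘ a) =
  a ∘ (Id ⊗ₘ swap X Z W) ∘ swap X Y (Z ⊗ W).
Proof.
rewrite !swapE hexagon1 !bmor_compm1 !bmor_comp1m -!compA.
rewrite (comp_reassoc (pentagon_fwd _ _ _ _)) -!compA.
rewrite -bmor_comp1m bwdK bmor_id compm1.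
rewrite (comp_reassoc (assoc_nat1 _ _ _)) -!compA.
rewrite (comp_reassoc (pentagon_bwd _ _ _ _)) -!compA.
rewrite (comp_reassoc (assoc_nat2 _ _ _)) -!compA.
by rewrite (comp_reassoc (pentagon_fwd _ _ _ _)) -!compA bwd_fwd_comp.
Qed.

Lemma swap_unitl X W : (Id ⊗ₘ lun W) ∘ swap 𝟙 X W = lun (X ⊗ W).
Proof.
rewrite swapE -triangle -!compA fwd_bwd_comp compA -bmor_compm1 run_braid.
exact: lun_tens.
Qed.

Lemma swap_unitr X W : lun (X ⊗ W) ∘ swap X 𝟙 W = Id ⊗ₘ lun W.
Proof.
rewrite swapE -lun_tens -!compA fwd_bwd_comp compA -bmor_compm1 lun_braid.
exact: triangle.
Qed.

Definition swapV X Y W : Mor (Y ⊗ (X ⊗ W)) (X ⊗ (Y ⊗ W)) :=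
  bwd (assoc X Y W) ∘ (bwd (braid X Y) ⊗ₘ Id) ∘ assoc Y X W.

Lemma swapVK X Y W : swap X Y W ∘ swapV X Y W = Id.
Proof.
rewrite swapE /swapV -!compA fwd_bwd_comp (comp_reassoc (h := Id)).
  by rewrite comp1m bwdK.
by rewrite -bmor_compm1 fwdK bmor_id.
Qed.

End Hat.

(** * The lax monoidal structure of the contragredient functor *)

Section Contragredient.
Variables (F : fieldType) (C : brcat F) (K : contragredient C).
Implicit Types X Y Z W V : C.
Local Notation Id := (idm _).
Local Notation a := (assoc _ _ _).

Lemma cmor0 X Y : cmor K (0 : Mor X Y) = 0.
Proof. by have := cmor_lin K (-1) (0 : Mor X Y) 0; rewrite scaleN1r addNr scaleN1r addNr. Qed.

Lemma cmorD X Y (f g : Mor X Y) : cmor K (f + g) = cmor K f + cmor K g.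
Proof. by have := cmor_lin K 1 f g; rewrite !scale1r. Qed.

Lemma cmor_sum X Y (T : Type) (r : seq T) (f : T -> Mor X Y) :
  cmor K (\sum_(t <- r) f t) = \sum_(t <- r) cmor K (f t).
Proof. by apply: big_morph => [f1 f2|]; rewrite (cmorD, cmor0). Qed.

Lemma cmorZ X Y c (f : Mor X Y) : cmor K (c *: f) = c *: cmor K f.
Proof. by have := cmor_lin K c f 0; rewrite cmor0 !addr0. Qed.

Lemma cgamma0 X Y : cgamma K (0 : Mor (X ⊗ Y) 𝟙) = 0.
Proof.
by have := cgamma_lin K (-1) (0 : Mor (X ⊗ Y) 𝟙) 0; rewrite scaleN1r addNr scaleN1r addNr.
Qed.

Fact cgamma_surj V Y (g : Mor V (K Y)) : exists f : Mor (V ⊗ Y) 𝟙, cgamma K f = g.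
Proof. by have [h _ hK] := cgamma_bij K V Y; exists (h g). Qed.

Lemma cgamma_inj V Y : injective (@cgamma _ _ K V Y).
Proof. by have /bij_inj := cgamma_bij K V Y. Qed.

(* The counit of the representation [Hom(V ⊗ X, 𝟙) = Hom(V, K X)]. *)
Definition pair X : Mor (K X ⊗ X) 𝟙 := projT1 (cid (cgamma_surj (idm (K X)))).

Lemma cgamma_pair X : cgamma K (pair X) = Id.
Proof. by rewrite /pair; case: cid. Qed.

Lemma cgamma_pairl V Y (g : Mor V (K Y)) : cgamma K (pair Y ∘ (g ⊗ₘ Id)) = g.
Proof. by rewrite cgamma_nat cgamma_pair cmor_id !comp1m. Qed.

Lemma pairK V Y (f : Mor (V ⊗ Y) 𝟙) : pair Y ∘ (cgamma K f ⊗ₘ Id) = f.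
Proof. by apply: cgamma_inj; rewrite cgamma_pairl. Qed.

Lemma pair_inj V Y (g h : Mor V (K Y)) :
  pair Y ∘ (g ⊗ₘ Id) = pair Y ∘ (h ⊗ₘ Id) -> g = h.
Proof. by move=> e; rewrite -(cgamma_pairl g) e cgamma_pairl. Qed.

Lemma pair_dinatural X Y (f : Mor X Y) :
  pair X ∘ (cmor K f ⊗ₘ Id) = pair Y ∘ (Id ⊗ₘ f).
Proof.
by apply: cgamma_inj; rewrite cgamma_pairl cgamma_nat cgamma_pair !compm1.
Qed.

(** The pairing on right-nested words: [K X] is contracted with the adjacent letter [X]. *)
Definition hat X W : Mor (K X ⊗ (X ⊗ W)) W :=
  locked (lun W ∘ (pair X ⊗ₘ Id) ∘ a).

Lemma hatE X W : hat X W = lun W ∘ (pair X ⊗ₘ Id) ∘ a.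
Proof. by rewrite /hat -lock. Qed.

Lemma hat_nat X W W' (f : Mor W W') :
  hat X W' ∘ (Id ⊗ₘ (Id ⊗ₘ f)) = f ∘ hat X W.
Proof.
rewrite !hatE -!compA -assoc_nat3 (comp_reassoc (tens_interchange _ _)) -compA.
by rewrite (comp_reassoc (lun_nat _)) -compA.
Qed.

Lemma hat_dinatural X Y W (f : Mor X Y) :
  hat X W ∘ (cmor K f ⊗ₘ Id) = hat Y W ∘ (Id ⊗ₘ (f ⊗ₘ Id)).
Proof.
rewrite !hatE -!compA -assoc_nat1 -assoc_nat2 !(comp_reassoc (esym (bmor_compm1 _ _ _ _))).
by rewrite pair_dinatural.
Qed.

(** [K Y] represents [Hom(- ⊗ Y, 𝟙)], so contraction separates the maps into it; the tail [𝟙] makes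
    the test word right-nested. *)
Lemma hat_inj V Y (g h : Mor V (K Y)) :
  hat Y 𝟙 ∘ (g ⊗ₘ Id) = hat Y 𝟙 ∘ (h ⊗ₘ Id) -> g = h.
Proof.
rewrite !hatE -!compA -!assoc_nat1 !(comp_reassoc (esym (bmor_compm1 _ _ _ _))).
by move=> /iso_epi_eq /iso_mono_eq /run_faithful /pair_inj.
Qed.

(** [K Y] passes over [X] and is contracted with [Y]: this is [can_mid] on right-nested words. *)
Definition slide X Y W : Mor (K Y ⊗ (X ⊗ (Y ⊗ W))) (X ⊗ W) :=
  locked ((Id ⊗ₘ hat Y W) ∘ swap (K Y) X (Y ⊗ W)).

Lemma slideE X Y W : slide X Y W = (Id ⊗ₘ hat Y W) ∘ swap (K Y) X (Y ⊗ W).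
Proof. by rewrite /slide -lock. Qed.

(** By naturality of the braiding at [pair Y], moving [V] past [K Y ⊗ Y] before contracting has no
    effect, since the braiding with [𝟙] is trivial. *)
Lemma hat_swap V Y W :
  hat Y (V ⊗ W) ∘ ((Id ⊗ₘ swap V Y W) ∘ swap V (K Y) (Y ⊗ W)) = Id ⊗ₘ hat Y W.
Proof.
rewrite !hatE -!compA (compA a) -swap_tensr.
by rewrite (comp_reassoc (esym (swap_nat2 _ _ _))) -compA !bmor_comp1m
  (comp_reassoc (swap_unitr _ _)) compA.
Qed.

(** Here [K Y ⊗ Y] as a whole passes over [X], and naturality at [pair Y] again allows contracting
    it first. *)
Lemma slide_swap Y X W : slide X Y W ∘ (Id ⊗ₘ swap Y X W) = hat Y (X ⊗ W).
Proof.
have e := swap_tensl (K Y) Y X W; rewrite -!compA in e.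
rewrite slideE !hatE !bmor_comp1m -!compA -e (comp_reassoc (esym (swap_nat1 _ _ _))).
by rewrite -!compA (comp_reassoc (swap_unitl _ _)).
Qed.

Lemma slide_nat X Y Y' W (f : Mor Y' Y) :
  slide X Y' W ∘ (cmor K f ⊗ₘ Id) = slide X Y W ∘ (Id ⊗ₘ (Id ⊗ₘ (f ⊗ₘ Id))).
Proof.
rewrite !slideE -!compA swap_nat1 swap_nat3 !compA.
by rewrite -!bmor_comp1m hat_dinatural.
Qed.

Lemma slide_natX X X' Y W (f : Mor X X') :
  slide X' Y W ∘ (Id ⊗ₘ (f ⊗ₘ Id)) = (f ⊗ₘ Id) ∘ slide X Y W.
Proof. by rewrite !slideE -!compA swap_nat2 compA -tens_interchange -compA. Qed.

Lemma slide_tens X Y Z W :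
  slide (X ⊗ Y) Z W ∘ (Id ⊗ₘ a) = a ∘ ((Id ⊗ₘ slide Y Z W) ∘ swap (K Z) X (Y ⊗ (Z ⊗ W))).
Proof.
rewrite !slideE -!compA swap_tensr !compA -bmor_id; congr (_ ∘ _).
by rewrite bmor_comp1m bmor_id assoc_nat3 !compA.
Qed.

(* [K Y] is moved over [X] with the braiding itself, not with the inverse of
   [braid X (K Y)]: this is the choice which, with the reversed braiding on the
   second factor, makes the algebra commutative. *)
Definition can_mid X Y : Mor (K Y ⊗ (X ⊗ Y)) X :=
  run X ∘ (Id ⊗ₘ pair Y) ∘ bwd a ∘ (braid (K Y) X ⊗ₘ Id) ∘ a.

Definition can_form X Y : Mor ((K X ⊗ K Y) ⊗ (X ⊗ Y)) 𝟙 :=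
  pair X ∘ (Id ⊗ₘ can_mid X Y) ∘ bwd a.

Definition can X Y : Mor (K X ⊗ K Y) (K (X ⊗ Y)) := cgamma K (can_form X Y).

Lemma can_mid_slide X Y W :
  (can_mid X Y ⊗ₘ Id) ∘ (a ∘ (Id ⊗ₘ a)) = slide X Y W.
Proof.
rewrite /can_mid slideE hatE swapE !bmor_compm1 !bmor_comp1m -!compA.
rewrite pentagon_right (comp_reassoc (assoc_nat1 _ _ _)).
rewrite -!compA (comp_reassoc (pentagon_bwd _ _ _ _)) -!compA.
rewrite (comp_reassoc (assoc_nat2 _ _ _)) -!compA.
by rewrite (comp_reassoc (triangle _ _)).
Qed.

(** The defining property of [can] on right-nested words. All coherence laws of [can] are obtained
    by evaluating both sides with it. *)
Lemma hat_can X Y W :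
  hat (X ⊗ Y) W ∘ ((can X Y ⊗ₘ a) ∘ a) = hat X W ∘ (Id ⊗ₘ slide X Y W).
Proof.
rewrite -{1}(compm1 (can X Y)) -{1}(comp1m (assoc X Y W)) bmor_comp.
rewrite !hatE -!compA (comp_reassoc (esym (assoc_nat1 _ _ _))) -!compA.
rewrite (comp_reassoc (esym (bmor_compm1 _ _ _ _))) pairK /can_form !bmor_compm1.
rewrite -!compA assoc_nat3 (comp_reassoc (pentagon _ _ _ _)) -!compA.
rewrite (comp_reassoc (h := Id)) ?comp1m; last by rewrite -bmor_compm1 bwdK bmor_id.
by rewrite (comp_reassoc (assoc_nat2 _ _ _)) -!compA -!bmor_comp1m can_mid_slide.
Qed.

(** The isomorphisms [u] and [w] rebracket the test word into the right-nested form on which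
    [hat_can] computes. *)
Lemma hat_inj_iso V Y Z T (u : iso Z (Y ⊗ 𝟙)) (w : iso T (V ⊗ Z)) (g h : Mor V (K Y)) :
  hat Y 𝟙 ∘ ((g ⊗ₘ u) ∘ w) = hat Y 𝟙 ∘ ((h ⊗ₘ u) ∘ w) -> g = h.
Proof.
rewrite !compA => /iso_mono_eq e; apply: hat_inj.
apply: (iso_mono_eq (f := bmor_iso _ (iso_id V) u)) => /=.
by rewrite -!compA -!bmor_comp !compm1 !comp1m.
Qed.

Lemma hat_cmor V X Y Z W (f : Mor X Y) (g : Mor V (K Y)) (h : Mor Z (X ⊗ W)) :
  hat X W ∘ ((cmor K f ∘ g) ⊗ₘ h) = hat Y W ∘ (g ⊗ₘ ((f ⊗ₘ Id) ∘ h)).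
Proof.
by rewrite -{1}(comp1m h) bmor_comp compA hat_dinatural -compA -bmor_comp comp1m.
Qed.

Lemma hat_can_comp U V X Y Z W (u : Mor U (K X)) (v : Mor V (K Y))
    (h : Mor Z (X ⊗ (Y ⊗ W))) :
  hat (X ⊗ Y) W ∘ (((can X Y ∘ (u ⊗ₘ v)) ⊗ₘ (a ∘ h)) ∘ a) =
  hat X W ∘ (u ⊗ₘ (slide X Y W ∘ (v ⊗ₘ h))).
Proof.
rewrite bmor_comp -compA -assoc_nat (compA (_ ⊗ₘ _)) compA hat_can.
by rewrite -compA -bmor_comp comp1m.
Qed.

Lemma can_nat X X' Y Y' (f : Mor X Y) (g : Mor X' Y') :
  cmor K (f ⊗ₘ g) ∘ can Y Y' = can X X' ∘ (cmor K f ⊗ₘ cmor K g).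
Proof.
apply: (hat_inj_iso (u := a) (w := a)).
rewrite compA hat_cmor -assoc_nat -[can Y Y']compm1 -bmor_id -compA hat_can_comp.
rewrite -[fwd (assoc X X' _)]compm1 hat_can_comp -[cmor K f]compm1 hat_cmor.
rewrite slide_nat (compA (f ⊗ₘ _)) -slide_natX -compA -!bmor_comp.
by rewrite !comp1m !compm1.
Qed.

(** [can Y Z] passes through the braiding by naturality, and the second hexagon moves [K Z] and
    [K Y] over [X] one after the other. *)
Lemma slide_can X Y Z W :
  slide X (Y ⊗ Z) W ∘ ((can Y Z ⊗ₘ (Id ⊗ₘ a)) ∘ a) =
  slide X Y W ∘ (Id ⊗ₘ ((Id ⊗ₘ slide Y Z W) ∘ swap (K Z) X (Y ⊗ (Z ⊗ W)))).
Proof.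
rewrite [LHS]compA slideE -(compA (_ ⊗ₘ hat _ _)) swap_nat -!compA swap_tensl -!compA.
rewrite (comp_reassoc (esym (bmor_comp1m _ _ _ _))).
rewrite (comp_reassoc (esym (bmor_comp1m _ _ _ _))) -!compA hat_can.
by rewrite !bmor_comp1m -!compA (comp_reassoc (esym (swap_nat3 _ _ _))) (slideE X) -!compA.
Qed.

Lemma can_assoc X Y Z :
  cmor K a ∘ can (X ⊗ Y) Z ∘ (can X Y ⊗ₘ Id) ∘ a =
  can X (Y ⊗ Z) ∘ (Id ⊗ₘ can Y Z).
Proof.
apply: (hat_inj_iso (u := iso_comp a (bmor_iso _ (iso_id X) a))
  (w := iso_comp a (bmor_iso _ (iso_id (K X)) a))) => /=.
(* The common value contracts [Z], then [Y], then [X], each contragredient sliding over the letters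
   in between. *)
transitivity (hat X 𝟙 ∘ (Id ⊗ₘ (slide X Y 𝟙 ∘
  (Id ⊗ₘ ((Id ⊗ₘ slide Y Z 𝟙) ∘ swap (K Z) X (Y ⊗ (Z ⊗ 𝟙))))))).
  rewrite -!(compA (cmor _ _)) compA hat_cmor pentagon_right.
  rewrite -(compm1 (assoc (X ⊗ Y) Z _ ∘ assoc X Y _)) bmor_comp -!compA pentagon_right.
  rewrite (compA (_ ⊗ₘ _)) compA hat_can_comp slide_tens.
  by rewrite -[can X Y]compm1 -(bmor_id tens (K X)) -compA hat_can_comp.
rewrite (compA (_ ⊗ₘ _)) compA hat_can_comp.
by rewrite -compA -bmor_comp1m -compA slide_can.
Qed.

Definition can_unit : Mor 𝟙 (K 𝟙) := cgamma K (lun 𝟙).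

Lemma hat_unit Z W (h : Mor Z (𝟙 ⊗ W)) :
  hat 𝟙 W ∘ (can_unit ⊗ₘ h) = lun W ∘ h ∘ lun Z.
Proof.
rewrite -[can_unit]compm1 -{1}(comp1m h) bmor_comp hatE -!compA.
rewrite (comp_reassoc (esym (assoc_nat1 _ _ _))) -!compA.
rewrite (comp_reassoc (esym (bmor_compm1 _ _ _ _))).
by rewrite pairK (comp_reassoc (lun_tens _ _)) lun_nat.
Qed.

Lemma can_unitl X : can 𝟙 X ∘ (can_unit ⊗ₘ Id) = cmor K (lun X) ∘ lun (K X).
Proof.
apply: (hat_inj_iso (u := a) (w := a)).
rewrite [RHS]compA hat_cmor lun_tens -(compm1 (fwd (assoc 𝟙 X _))) hat_can_comp.
rewrite hat_unit bmor_id compm1 slideE (compA (lun _)) lun_nat -!compA.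
rewrite (comp_reassoc (swap_unitr _ _)) -(lun_tens (K X)).
by rewrite (compA (_ ⊗ₘ _) (_ ⊗ₘ _)) -bmor_comp comp1m compm1.
Qed.

Lemma can_unitr X : can X 𝟙 ∘ (Id ⊗ₘ can_unit) = cmor K (run X) ∘ run (K X).
Proof.
apply: (hat_inj_iso (u := a) (w := a)).
rewrite [RHS]compA hat_cmor triangle -(compm1 (fwd (assoc X 𝟙 _))) hat_can_comp.
rewrite slideE -!compA swap_nat1 (compA (_ ⊗ₘ _)) -bmor_comp1m hat_unit compm1.
rewrite (bmor_comp1m _ _ (lun 𝟙)) -compA swap_unitl bmor_comp1m -(triangle (K X)).
by rewrite (compA (_ ⊗ₘ _)) -bmor_comp comp1m compm1.
Qed.

(** Tested on [K X ⊗ K Y ⊗ Y ⊗ X], both sides contract the inner pair in place and then the outer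
    one, by [slide_swap] and [hat_swap]. *)
Lemma can_braid X Y :
  can Y X ∘ braid (K X) (K Y) = cmor K (braid Y X) ∘ can X Y.
Proof.
apply: (hat_inj_iso (u := a) (w := a)).
rewrite [RHS]compA hat_cmor -assoc_swap -[can X Y]compm1 -(bmor_id tens (K X)).
rewrite -(compA (hat _ _)) hat_can_comp slide_swap.
rewrite -(compm1 (fwd (assoc Y X _))) bmor_comp -(compA (_ ⊗ₘ _)) -assoc_swap.
rewrite (compA (_ ⊗ₘ _)) compA hat_can slideE bmor_comp1m (compA (hat _ _)).
by rewrite hat_nat -!compA hat_swap.
Qed.

(** * Nondegeneracy of the pairings in the rigid case *)

Section Rigid.
Hypothesis K_dual : duals K.

Lemma assoc_bwd_nat2 X Y Y' Z (f : Mor Y Y') :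
  bwd (assoc X Y' Z) ∘ ((Id ⊗ₘ f) ⊗ₘ Id) = (Id ⊗ₘ (f ⊗ₘ Id)) ∘ bwd a.
Proof.
apply: (iso_epi_eq (f := assoc X Y' Z)); rewrite fwd_bwd_comp compA -assoc_nat2.
by rewrite -compA fwdK compm1.
Qed.

(* [K] need not be the duality functor attached to [K_dual], but [pair X] and
   [ev K_dual X] represent the same functor [Hom(- ⊗ X, 𝟙)], so that [pair X]
   is the evaluation of a duality as well. *)
Lemma pair_coev X : exists c : Mor 𝟙 (X ⊗ K X),
  run X ∘ (Id ⊗ₘ pair X) ∘ bwd a ∘ (c ⊗ₘ Id) = lun X.
Proof.
exists ((Id ⊗ₘ cgamma K (ev K_dual X)) ∘ coev K_dual X).
rewrite bmor_compm1 -!compA (comp_reassoc (assoc_bwd_nat2 _ _ _)) -compA.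
rewrite (comp_reassoc (esym (bmor_comp1m _ _ _ _))) pairK.
apply: (iso_mono_eq (f := iso_sym (lun X))) => /=.
by have := zigzag1 K_dual X; rewrite fwdK -!compA => ->.
Qed.

(** The zigzag identity recovers [v] from its contraction by means of the coevaluation of [X]. *)
Lemma hat_nondegenerate V X W (v : Mor V (X ⊗ W)) : hat X W ∘ (Id ⊗ₘ v) = 0 -> v = 0.
Proof.
move=> v0; have [c cP] := pair_coev X.
have zigzag : (Id ⊗ₘ hat X W) ∘ (bwd a ∘ (c ⊗ₘ Id)) = lun (X ⊗ W).
  have aa : (Id ⊗ₘ assoc (K X) X W) ∘ bwd (assoc X (K X) (X ⊗ W)) =
      bwd a ∘ ((bwd (assoc X (K X) X) ⊗ₘ Id) ∘ a).
    by rewrite pentagon_bwd -!compA bwd_fwd_comp.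
  rewrite hatE !bmor_comp1m -!compA (comp_reassoc aa) -!compA -assoc_nat1.
  rewrite (comp_reassoc (esym (assoc_bwd_nat2 _ _ _))) -compA.
  have lr : (Id ⊗ₘ lun W) ∘ bwd (assoc X 𝟙 W) = run X ⊗ₘ Id.
    by rewrite -triangle -compA fwdK compm1.
  by rewrite (comp_reassoc lr) -lun_tens -cP !bmor_compm1 -!compA.
apply: (iso_mono_eq (f := lun V)); rewrite comp0m -lun_nat -zigzag -!compA.
rewrite tens_interchange.
have an : bwd (assoc X (K X) (X ⊗ W)) ∘ (Id ⊗ₘ v) = (Id ⊗ₘ (Id ⊗ₘ v)) ∘ bwd a.
  apply: (iso_epi_eq (f := a)); rewrite fwd_bwd_comp compA -assoc_nat3.
  by rewrite -compA fwdK compm1.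
by rewrite (comp_reassoc an) -compA compA -bmor_comp1m v0 bmor0r comp0m.
Qed.

(** The hypothesis says that [u] vanishes once contracted with [K X] and [K Y]; nondegeneracy for
    [X] and then for [Y] removes the two contractions. *)
Lemma can_nondegenerate X Y Z (u : Mor Z (X ⊗ Y)) : cmor K u ∘ can X Y = 0 -> u = 0.
Proof.
move=> u0; apply: run_faithful; rewrite bmor0l.
apply: (iso_epi_eq (f := iso_sym a)) => /=; rewrite compm0.
set v := bwd _ ∘ _.
(* With [Y] moved to the front, the slide becomes a plain contraction by [slide_swap]. *)
suff v0 : swapV Y X 𝟙 ∘ v = 0.
  by rewrite -[v]comp1m -(swapVK Y X 𝟙) -compA v0 compm0.
have h0 : hat X 𝟙 ∘ (Id ⊗ₘ (slide X Y 𝟙 ∘ (Id ⊗ₘ v))) = 0.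
  rewrite -hat_can_comp bmor_id compm1 /v fwd_bwd_comp.
  rewrite -[_ ⊗ₘ Id]compm1 compA -hat_cmor u0.
  by rewrite bmor0l compm0 comp0m.
apply: (hat_nondegenerate (X := Y)); rewrite -slide_swap -compA -bmor_comp1m.
rewrite [in X in _ ∘ X](_ : swap Y X 𝟙 ∘ (swapV Y X 𝟙 ∘ v) = v).
  exact: hat_nondegenerate h0.
by rewrite compA swapVK comp1m.
Qed.

End Rigid.

End Contragredient.

(** * Elements of formal direct sums *)

Section Elements.
Variables (F : fieldType) (D : brcat F).
Local Notation DS := (dsum_brcat D).
Local Notation Id := (idm _).
Implicit Types (V W : D) (X Y Z : DS).

Definition single V : DS := dsingle V.

Definition slift V W (f : Mor V W) : Mor (single V) (single W) :=
  dmap (X := dsingle V) (Y := dsingle W) (phi := id) (fun=> f).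

(** A map from a one-term sum is treated as a generalized element of [X], described by its finitely
    many nonzero components. *)
Definition elt V X (x : Mor (single V) X) (i : ix X) : Mor V (X i) := ent x tt i.

Definition dinj X (s : ix X) : Mor (single (X s)) X :=
  dmap (X := dsingle (X s)) (Y := X) (phi := fun=> s) (fun=> Id).

(** Needed because [single V ⊗ single W] is indexed by [unit * unit] instead of [unit]. *)
Definition single_tens V W : Mor (single (V ⊗ W)) (single V ⊗ single W) :=
  dmap (X := dsingle (V ⊗ W)) (Y := dtens_ob (dsingle V) (dsingle W))
    (phi := fun=> (tt, tt)) (fun=> Id).

Lemma elt_inj V X (x y : Mor (single V) X) : (forall i, elt x i = elt y i) -> x = y.
Proof. by move=> e; apply: dsum_homP => -[] i; apply: e. Qed.

Lemma elt_comp_inj X Y (f : Mor X Y) s t : elt (f ∘ dinj s) t = ent f s t.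
Proof. by rewrite /elt [LHS](dcomp_mapr (X := dsingle (X s))) compm1. Qed.

Lemma inj_ext X Y (f g : Mor X Y) : (forall s, f ∘ dinj s = g ∘ dinj s) -> f = g.
Proof. by move=> e; apply: dsum_homP => s t; rewrite -!elt_comp_inj e. Qed.

Lemma elt_slift V W X (x : Mor (single W) X) (f : Mor V W) i :
  elt (x ∘ slift f) i = elt x i ∘ f.
Proof. by rewrite /elt [LHS](dcomp_mapr (X := dsingle V)). Qed.

Lemma elt_inj_id X (s : ix X) : elt (dinj s) s = Id.
Proof. exact: (dmap_entE (X := dsingle (X s)) (phi := fun=> s) (fun=> Id) tt). Qed.

Lemma elt_inj0 X (s t : ix X) : s <> t -> elt (dinj s) t = 0.
Proof. exact: (dmap_ent0 (X := dsingle (X s)) (phi := fun=> s) (fun=> Id)). Qed.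

Lemma elt0 V X i : elt (0 : Mor (single V) X) i = 0.
Proof. by []. Qed.

Lemma eltD V X (x y : Mor (single V) X) i : elt (x + y) i = elt x i + elt y i.
Proof. by []. Qed.

Lemma eltZ V X c (x : Mor (single V) X) i : elt (c *: x) i = c *: elt x i.
Proof. by []. Qed.

Lemma elt_sum V X (T : Type) (r : seq T) (x : T -> Mor (single V) X) i :
  elt (\sum_(t <- r) x t) i = \sum_(t <- r) elt (x t) i.
Proof. by apply: (big_morph (fun x => elt x i)). Qed.

Lemma elt_sliftE V W (f : Mor V W) : elt (slift f) tt = f.
Proof. exact: (dmap_entE (X := dsingle V) (Y := dsingle W) (phi := id) (fun=> f) tt). Qed.

Lemma slift_comp U V W (g : Mor V W) (f : Mor U V) : slift (g ∘ f) = slift g ∘ slift f.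
Proof. by apply: elt_inj => -[]; rewrite elt_slift !elt_sliftE. Qed.

Lemma sliftZ V W c (f : Mor V W) : slift (c *: f) = c *: slift f.
Proof. by apply: elt_inj => -[]; rewrite eltZ !elt_sliftE. Qed.

Lemma sliftD V W (f g : Mor V W) : slift (f + g) = slift f + slift g.
Proof. by apply: elt_inj => -[]; rewrite eltD !elt_sliftE. Qed.

Lemma slift0 V W : slift (0 : Mor V W) = 0.
Proof. by apply: elt_inj => -[]; rewrite elt_sliftE. Qed.

Lemma slift_sum V W (T : Type) (r : seq T) (f : T -> Mor V W) :
  slift (\sum_(t <- r) f t) = \sum_(t <- r) slift (f t).
Proof. by apply: big_morph => [f1 f2|]; rewrite (sliftD, slift0). Qed.

Lemma slift_id V : slift (idm V) = Id.
Proof. by []. Qed.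

Lemma inj_expand V X (x : Mor (single V) X) (r : seq (ix X)) :
  uniq r -> (forall i, elt x i != 0 -> i \in r) ->
  x = \sum_(i <- r) dinj i ∘ slift (elt x i).
Proof.
move=> ur rP; apply: elt_inj => i; rewrite elt_sum.
have [ir|ir] := boolP (i \in r).
  rewrite (bigD1_seq i) // elt_slift elt_inj_id comp1m big1 => [|j ji]; first by rewrite [RHS]addr0.
  by rewrite elt_slift elt_inj0 ?comp0m //; apply/eqP.
have /eqP -> : elt x i == 0 by apply: contraNT ir => /rP.
rewrite big1_seq // => j /andP[_ jr]; rewrite elt_slift elt_inj0 ?comp0m // => ji.
by rewrite -ji jr in ir.
Qed.

Lemma elt_single_tens V W X (h : Mor (single V ⊗ single W) X) i :
  elt (h ∘ single_tens V W) i = ent h (tt, tt) i.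
Proof. by rewrite /elt [LHS](dcomp_mapr (X := dsingle (V ⊗ W))) compm1. Qed.

Definition etens V W X Y (x : Mor (single V) X) (y : Mor (single W) Y) :
  Mor (single (V ⊗ W)) (X ⊗ Y) := (x ⊗ₘ y) ∘ single_tens V W.

Lemma elt_etens V W X Y (x : Mor (single V) X) (y : Mor (single W) Y) s t :
  elt (etens x y) (s, t) = elt x s ⊗ₘ elt y t.
Proof. exact: elt_single_tens. Qed.

Lemma etens_slift V V' W W' X Y (x : Mor (single V') X) (y : Mor (single W') Y)
    (f : Mor V V') (g : Mor W W') :
  etens (x ∘ slift f) (y ∘ slift g) = etens x y ∘ slift (f ⊗ₘ g).
Proof. by apply: elt_inj => -[s t]; rewrite elt_slift !elt_etens !elt_slift bmor_comp. Qed.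

Lemma etens_mor V W X X' Y Y' (x : Mor (single V) X) (y : Mor (single W) Y)
    (f : Mor X X') (g : Mor Y Y') :
  etens (f ∘ x) (g ∘ y) = (f ⊗ₘ g) ∘ etens x y.
Proof. by rewrite /etens bmor_comp compA. Qed.

Lemma inj_tens X Y (s : ix X) (t : ix Y) :
  dinj (X := X ⊗ Y) (s, t) = etens (dinj s) (dinj t).
Proof.
apply: elt_inj => -[s' t']; rewrite elt_etens.
have [<-|ss] := s =P s'; last first.
  by rewrite (elt_inj0 ss) bmor0l elt_inj0 // => -[].
have [<-|tt'] := t =P t'; last first.
  by rewrite (elt_inj0 tt') bmor0r elt_inj0 // => -[].
by rewrite !elt_inj_id bmor_id.
Qed.

Definition copair X Y (x : forall s, Mor (single (X s)) Y) : Mor X Y :=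
  DSumHom (fun s => ent_fin (x s) tt).

Lemma copair_inj X Y (x : forall s, Mor (single (X s)) Y) s : copair x ∘ dinj s = x s.
Proof. by apply: elt_inj => t; rewrite elt_comp_inj. Qed.

Lemma assoc_inj X Y Z s t u :
  assoc X Y Z ∘ dinj (X := X ⊗ (Y ⊗ Z)) (s, (t, u)) =
  dinj (X := X ⊗ Y ⊗ Z) (s, t, u) ∘ slift (assoc (X s) (Y t) (Z u)).
Proof.
apply: elt_inj => -[[s' t'] u']; rewrite elt_comp_inj elt_slift.
have [[<- <- <-]|n] := (s, t, u) =P (s', t', u').
  rewrite elt_inj_id comp1m.
  exact: (dmap_entE (X := X ⊗ (Y ⊗ Z)) (Y := X ⊗ Y ⊗ Z)
    (phi := fun p => ((p.1, p.2.1), p.2.2))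
    (fun p => fwd (assoc (X p.1) (Y p.2.1) (Z p.2.2))) (s, (t, u))).
rewrite elt_inj0 // comp0m.
exact: (dmap_ent0 (X := X ⊗ (Y ⊗ Z)) (Y := X ⊗ Y ⊗ Z)
    (phi := fun p => ((p.1, p.2.1), p.2.2))
    (fun p => fwd (assoc (X p.1) (Y p.2.1) (Z p.2.2))) (s := (s, (t, u)))).
Qed.

Lemma lun_inj X s :
  lun X ∘ dinj (X := 𝟙 ⊗ X) (tt, s) = dinj s ∘ slift (lun (X s)).
Proof.
apply: elt_inj => t; rewrite elt_comp_inj elt_slift.
have [<-|n] := s =P t.
  rewrite elt_inj_id comp1m.
  exact: (dmap_entE (X := 𝟙 ⊗ X) (phi := fun p => p.2) (fun p => fwd (lun (X p.2))) (tt, s)).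
rewrite elt_inj0 // comp0m.
exact: (dmap_ent0 (X := 𝟙 ⊗ X) (phi := fun p => p.2) (fun p => fwd (lun (X p.2))) (s := (tt, s))).
Qed.

Lemma run_inj X s :
  run X ∘ dinj (X := X ⊗ 𝟙) (s, tt) = dinj s ∘ slift (run (X s)).
Proof.
apply: elt_inj => t; rewrite elt_comp_inj elt_slift.
have [<-|n] := s =P t.
  rewrite elt_inj_id comp1m.
  exact: (dmap_entE (X := X ⊗ 𝟙) (phi := fun p => p.1) (fun p => fwd (run (X p.1))) (s, tt)).
rewrite elt_inj0 // comp0m.
exact: (dmap_ent0 (X := X ⊗ 𝟙) (phi := fun p => p.1) (fun p => fwd (run (X p.1))) (s := (s, tt))).
Qed.

Lemma braid_inj X Y s t :
  braid X Y ∘ dinj (X := X ⊗ Y) (s, t) =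
  dinj (X := Y ⊗ X) (t, s) ∘ slift (braid (X s) (Y t)).
Proof.
apply: elt_inj => -[t' s']; rewrite elt_comp_inj elt_slift.
have [[<- <-]|n] := (t, s) =P (t', s').
  rewrite elt_inj_id comp1m.
  exact: (dmap_entE (X := X ⊗ Y) (Y := Y ⊗ X) (phi := fun p => (p.2, p.1))
    (fun p => fwd (braid (X p.1) (Y p.2))) (s, t)).
rewrite elt_inj0 // comp0m.
exact: (dmap_ent0 (X := X ⊗ Y) (Y := Y ⊗ X) (phi := fun p => (p.2, p.1))
    (fun p => fwd (braid (X p.1) (Y p.2))) (s := (s, t))).
Qed.

(** * Partial sums as subobjects *)

Section Subobject.
Variables (X : DS) (P : pred (ix X)).

Definition sub_sum : DS := DSumOb {i : ix X | P i} (fun i => X (val i)).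

Definition sub_in : Mor sub_sum X :=
  dmap (X := sub_sum) (Y := X) (phi := val) (fun=> Id).

Lemma ent_sub_in Y (g : Mor Y sub_sum) s t : ent (sub_in ∘ g) s (val t) = ent g s t.
Proof.
by rewrite [LHS](dcomp_mapl (Y := sub_sum) (Z := X) (phi := val)) ?comp1m.
Qed.

Lemma ent_sub_in0 Y (g : Mor Y sub_sum) s i : ~~ P i -> ent (sub_in ∘ g) s i = 0.
Proof.
move=> Pi; apply: fsbig1 => t _.
suff e : ent sub_in t i = 0 by rewrite e comp0m.
apply: (dmap_ent0 (X := sub_sum) (phi := val)) => ti.
by move: Pi; rewrite -ti (valP t).
Qed.

Lemma sub_in_mono : mono sub_in.
Proof. by move=> Y g h e; apply: dsum_homP => s t; rewrite -!ent_sub_in e. Qed.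

Lemma sub_in_dinj (t : ix sub_sum) : sub_in ∘ dinj t = dinj (val t).
Proof.
apply: elt_inj => i; rewrite elt_comp_inj.
have [<-|n] := val t =P i.
  apply: etrans (esym (elt_inj_id (val t))).
  exact: (dmap_entE (X := sub_sum) (Y := X) (phi := val) (fun=> Id)).
apply: etrans (esym (elt_inj0 n)).
exact: (dmap_ent0 (X := sub_sum) (Y := X) (phi := val) (fun=> Id)).
Qed.

Lemma sub_in_factor Y (x : Mor Y X) :
  (forall s i, ~~ P i -> ent x s i = 0) -> factors_through x sub_in.
Proof.
move=> x0.
have fin s : finite_set [set t : ix sub_sum | ent x s (val t) != 0].
  apply: (finite_preimage (f := val)) (ent_fin x s).
  by move=> ? ? _ _; apply: val_inj.
exists (DSumHom fin : Mor Y sub_sum); apply: dsum_homP => s i.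
have [Pi|Pi] := boolP (P i); last by rewrite ent_sub_in0 // x0.
exact: (ent_sub_in (DSumHom fin) s (exist _ i Pi)).
Qed.

End Subobject.

(** * Algebra axioms on generalized elements *)

Section Algebra.
Variables (A : DS) (mu : Mor (A ⊗ A) A).

Definition eprod V W (x : Mor (single V) A) (y : Mor (single W) A) :
  Mor (single (V ⊗ W)) A := mu ∘ etens x y.

Lemma eprod_slift V V' W W' (x : Mor (single V') A) (y : Mor (single W') A)
    (f : Mor V V') (g : Mor W W') :
  eprod (x ∘ slift f) (y ∘ slift g) = eprod x y ∘ slift (f ⊗ₘ g).
Proof. by rewrite /eprod etens_slift compA. Qed.

Lemma eprod_suml V W (T : Type) (r : seq T) (x : T -> Mor (single V) A)
    (y : Mor (single W) A) :
  eprod (\sum_(t <- r) x t) y = \sum_(t <- r) eprod (x t) y.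
Proof. by rewrite /eprod /etens bmor_suml comp_suml comp_sumr. Qed.

Lemma eprod_sumr V W (T : Type) (r : seq T) (x : Mor (single V) A)
    (y : T -> Mor (single W) A) :
  eprod x (\sum_(t <- r) y t) = \sum_(t <- r) eprod x (y t).
Proof. by rewrite /eprod /etens bmor_sumr comp_suml comp_sumr. Qed.

Lemma eprodZl V W c (x : Mor (single V) A) (y : Mor (single W) A) :
  eprod (c *: x) y = c *: eprod x y.
Proof. by rewrite /eprod /etens bmorZl compZl compZr. Qed.

Lemma eprodZr V W c (x : Mor (single V) A) (y : Mor (single W) A) :
  eprod x (c *: y) = c *: eprod x y.
Proof. by rewrite /eprod /etens bmorZr compZl compZr. Qed.

(** Maps out of a formal direct sum are determined on the summands, where the axiom becomes an
    equation between products of injections. *)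
Lemma mul_assoc_inj :
  (forall i j k, eprod (dinj i) (eprod (dinj j) (dinj k)) =
     eprod (eprod (dinj i) (dinj j)) (dinj k) ∘ slift (assoc (A i) (A j) (A k))) ->
  mu ∘ (Id ⊗ₘ mu) = mu ∘ (mu ⊗ₘ Id) ∘ assoc A A A.
Proof.
move=> H; apply: inj_ext => -[i [j k]].
rewrite -[RHS]compA assoc_inj [RHS]compA -!(compA mu) !inj_tens -!etens_mor !comp1m [RHS]compA.
exact: H.
Qed.

Lemma inj_one (u : Mor 𝟙 A) : u ∘ dinj (X := (𝟙 : DS)) tt = u.
Proof. by apply: elt_inj => t; apply: elt_comp_inj. Qed.

Lemma mul_unitl_inj (u : Mor 𝟙 A) :
  (forall i, eprod u (dinj i) = dinj i ∘ slift (lun (A i))) ->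
  mu ∘ (u ⊗ₘ Id) = lun A.
Proof.
move=> H; apply: inj_ext => -[[] i]; rewrite lun_inj -H -compA inj_tens -etens_mor.
by rewrite comp1m inj_one.
Qed.

Lemma mul_unitr_inj (u : Mor 𝟙 A) :
  (forall i, eprod (dinj i) u = dinj i ∘ slift (run (A i))) ->
  mu ∘ (Id ⊗ₘ u) = run A.
Proof.
move=> H; apply: inj_ext => -[i []]; rewrite run_inj -H -compA inj_tens -etens_mor.
by rewrite comp1m inj_one.
Qed.

Lemma mul_comm_inj :
  (forall i j, eprod (dinj j) (dinj i) ∘ slift (braid (A i) (A j)) = eprod (dinj i) (dinj j)) ->
  mu ∘ braid A A = mu.
Proof.
move=> H; apply: inj_ext => -[i j].
by rewrite -compA braid_inj compA !inj_tens H.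
Qed.

End Algebra.

End Elements.

(** * The canonical algebra *)

Section CanonicalAlgebra.
Variables (F : fieldType) (C : brcat F).
Hypotheses (C_abelian : is_abelian C) (C_schur : schur C).
Hypothesis C_semisimple : semisimple C.
Variables (K : contragredient C) (I : choiceType) (irr : I -> C).
Hypothesis irrP : irr_representatives irr.
(* [rev_brcat C] and [C] share their underlying monoidal category, so [box] is
   viewed as a bifunctor on [C * C]; only [box_tens_braid] sees the difference. *)
Variables (D : brcat F) (box : bilfun C C D).
Hypothesis box_cw : @componentwise F C (rev_brcat C) D box.
Implicit Types X Y Z W V : C.
Local Notation Id := (idm _).
Local Notation A := (canonical_object K box irr).
Local Notation dec := (dec C_semisimple irrP).

Definition box_tens {X1 Y1 X2 Y2} :
    iso (box X1 X2 ⊗ box Y1 Y2) (box (X1 ⊗ Y1) (X2 ⊗ Y2)) :=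
  cw box_cw X1 Y1 X2 Y2.

Definition box_unit : iso (𝟙 : D) (box 𝟙 𝟙) := cw1 box_cw.

Lemma box_tens_nat (X1 X1' Y1 Y1' X2 X2' Y2 Y2' : C)
    (f1 : Mor X1 X1') (f2 : Mor X2 X2') (g1 : Mor Y1 Y1') (g2 : Mor Y2 Y2') :
  box_tens ∘ (bmor box f1 f2 ⊗ₘ bmor box g1 g2) =
  bmor box (f1 ⊗ₘ g1) (f2 ⊗ₘ g2) ∘ box_tens.
Proof. exact: (cw_nat box_cw). Qed.

Lemma box_tens_assoc (X1 Y1 Z1 X2 Y2 Z2 : C) :
  box_tens ∘ (box_tens ⊗ₘ Id) ∘ assoc (box X1 X2) (box Y1 Y2) (box Z1 Z2) =
  bmor box (assoc X1 Y1 Z1) (assoc X2 Y2 Z2) ∘ box_tens ∘ (Id ⊗ₘ box_tens).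
Proof. exact: (cw_assoc box_cw). Qed.

Lemma box_tens_lun X1 X2 :
  bmor box (lun X1) (lun X2) ∘ box_tens ∘ (box_unit ⊗ₘ Id) = lun (box X1 X2).
Proof. exact: (cw_lun box_cw). Qed.

Lemma box_tens_run X1 X2 :
  bmor box (run X1) (run X2) ∘ box_tens ∘ (Id ⊗ₘ box_unit) = run (box X1 X2).
Proof. exact: (cw_run box_cw). Qed.

Lemma box_tens_braid X1 Y1 X2 Y2 :
  box_tens ∘ braid (box X1 X2) (box Y1 Y2) =
  bmor box (braid X1 Y1) (bwd (braid Y2 X2)) ∘ box_tens.
Proof. exact: (cw_braid box_cw). Qed.

(* [A] is the coend of [box (K X) X], and [coin] is its universal dinatural family. *)
Definition coin X : Mor (single (box (K X) X)) A :=
  \sum_k dinj (X := A) (dec_ix (dec X) k) ∘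
    slift (bmor box (cmor K (inc (dec X) k)) (prj (dec X) k)).

Lemma coin_dinatural X Y (f : Mor X Y) :
  coin Y ∘ slift (bmor box Id f) = coin X ∘ slift (bmor box (cmor K f) Id).
Proof.
rewrite /coin !comp_suml.
pose b j (g : Mor (irr j) Y) (h : Mor X (irr j)) :=
  dinj (X := A) j ∘ slift (bmor box (cmor K g) h).
transitivity (\sum_k b _ (inc (dec Y) k) (prj (dec Y) k ∘ f)).
  by apply: eq_bigr => k _; rewrite /b -compA -slift_comp -bmor_comp compm1.
rewrite -(decomp_dinatural C_abelian C_schur irrP (dec X)).
- apply: eq_bigr => k _.
  by rewrite /b -compA -slift_comp -bmor_comp compm1 cmor_comp.
- by move=> j c g g' h; rewrite /b cmor_lin bmor_linl sliftD sliftZ compDr compZr.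
- by move=> j c g h h'; rewrite /b bmor_linr sliftD sliftZ compDr compZr.
Qed.

Lemma dinj_dinatural i j (f : Mor (irr i) (irr j)) :
  dinj (X := A) j ∘ slift (bmor box Id f) = dinj (X := A) i ∘ slift (bmor box (cmor K f) Id).
Proof.
have [ij|ij] := eqVneq i j; last first.
  by rewrite (irr_mor0 C_abelian irrP f ij) cmor0 bmor0l bmor0r !slift0 !compm0.
case: j / ij f => f; have [c ->] := C_schur (irr_simple irrP i) f.
by rewrite cmorZ bmorZl bmorZr cmor_id.
Qed.

(** The decomposition chosen for [irr i] is arbitrary, so this is not definitional: dinaturality of
    the injections brings the projections and inclusions together. *)
Lemma coin_irr i : coin (irr i) = dinj (X := A) i.
Proof.
rewrite -[RHS]compm1 -slift_id -(bmor_id box) -(cmor_id K).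
rewrite -[X in cmor K X](sum_inc_prj (dec (irr i))).
rewrite cmor_sum bmor_suml slift_sum comp_sumr; apply: eq_bigr => k _.
rewrite cmor_comp bmor_compm1 slift_comp compA -dinj_dinatural -compA -slift_comp.
by rewrite -bmor_comp comp1m compm1.
Qed.

Definition canonical_mul : Mor (A ⊗ A) A :=
  copair (X := A ⊗ A) (fun p : ix (A ⊗ A) =>
    coin (irr p.1 ⊗ irr p.2) ∘ slift (bmor box (can K _ _) Id ∘ box_tens)).

Lemma mul_dinj i j : eprod canonical_mul (dinj (X := A) i) (dinj (X := A) j) =
  coin (irr i ⊗ irr j) ∘ slift (bmor box (can K _ _) Id ∘ box_tens).
Proof. by rewrite /eprod -inj_tens; apply: (copair_inj (X := A ⊗ A) _ (i, j)). Qed.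

(** The product is defined by this formula on representatives only. Naturality of [can] and
    dinaturality of [coin] extend it to all objects, so that [X ⊗ Y] need not be decomposed in the
    sequel. *)
Lemma coin_mul X Y :
  eprod canonical_mul (coin X) (coin Y) =
  coin (X ⊗ Y) ∘ slift (bmor box (can K X Y) Id ∘ box_tens).
Proof.
transitivity (\sum_k \sum_l coin (X ⊗ Y) ∘ slift (bmor box (can K X Y)
    ((inc (dec X) k ∘ prj (dec X) k) ⊗ₘ (inc (dec Y) l ∘ prj (dec Y) l)) ∘ box_tens)).
  rewrite [coin X]/coin eprod_suml; apply: eq_bigr => k _.
  rewrite [coin Y]/coin eprod_sumr; apply: eq_bigr => l _.
  rewrite eprod_slift mul_dinj -compA -slift_comp -compA box_tens_nat compA -bmor_comp.
  rewrite -can_nat comp1m -[prj _ k ⊗ₘ _]comp1m bmor_comp -compA slift_comp compA.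
  rewrite -coin_dinatural -compA -slift_comp compA -bmor_comp comp1m.
  by rewrite -bmor_comp.
rewrite -[in RHS](bmor_id tens).
rewrite -[in RHS](sum_inc_prj (dec X)) -[in RHS](sum_inc_prj (dec Y)).
rewrite tens_suml bmor_sumr comp_suml slift_sum comp_sumr; apply: eq_bigr => k _.
by rewrite tens_sumr bmor_sumr comp_suml slift_sum comp_sumr.
Qed.

Definition canonical_unit : Mor 𝟙 A := coin 𝟙 ∘ slift (bmor box (can_unit K) Id ∘ box_unit).

Lemma coin_mul_assoc X Y Z :
  eprod canonical_mul (coin X) (eprod canonical_mul (coin Y) (coin Z)) =
  eprod canonical_mul (eprod canonical_mul (coin X) (coin Y)) (coin Z) ∘
    slift (assoc (box (K X) X) (box (K Y) Y) (box (K Z) Z)).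
Proof.
rewrite !coin_mul -{1}[coin X]compm1 -{1}[coin Z]compm1 -!slift_id !eprod_slift !coin_mul.
rewrite -!compA -!slift_comp (bmor_comp1m tens) (bmor_compm1 tens).
rewrite -(bmor_id box (K X)) -(bmor_id box (K Z)) -!compA.
rewrite !(comp_reassoc (box_tens_nat _ _ _ _)) !bmor_id -!compA.
have := box_tens_assoc (K X) (K Y) (K Z) X Y Z; rewrite -!compA => ->.
rewrite !(compA (bmor box _ _) (bmor box _ _)) -!bmor_comp !comp1m.
rewrite (compA (bmor box (can K (X ⊗ Y) Z ∘ _) _)) -bmor_comp comp1m.
rewrite -[can K (X ⊗ Y) Z ∘ _ ∘ _]comp1m -[fwd (assoc X Y Z)]compm1 [in RHS]bmor_comp.
(* Dinaturality trades the associator of the second factor for its contragredient on the first,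
   where [can_assoc] applies. *)
rewrite -(compA (bmor box Id _)) [in RHS]slift_comp [RHS]compA coin_dinatural -compA -slift_comp.
by rewrite (compA (bmor box (cmor K _) _)) -bmor_comp comp1m !compA can_assoc.
Qed.

Lemma coin_mul_unitl X :
  eprod canonical_mul canonical_unit (coin X) = coin X ∘ slift (lun (box (K X) X)).
Proof.
rewrite -{1}[coin X]compm1 -slift_id eprod_slift coin_mul -!compA -slift_comp.
rewrite (bmor_compm1 tens) -(bmor_id box (K X)) -!compA.
rewrite (comp_reassoc (box_tens_nat _ _ _ _)) !bmor_id -compA.
rewrite (compA (bmor box _ _)) -bmor_comp comp1m can_unitl bmor_compm1 -compA.
rewrite slift_comp compA -coin_dinatural -compA -slift_comp -box_tens_lun !compA.
by rewrite -bmor_comp comp1m compm1.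
Qed.

Lemma coin_mul_unitr X :
  eprod canonical_mul (coin X) canonical_unit = coin X ∘ slift (run (box (K X) X)).
Proof.
rewrite -{1}[coin X]compm1 -slift_id eprod_slift coin_mul -!compA -slift_comp.
rewrite (bmor_comp1m tens) -(bmor_id box (K X)) -!compA.
rewrite (comp_reassoc (box_tens_nat _ _ _ _)) !bmor_id -compA.
rewrite (compA (bmor box _ _)) -bmor_comp comp1m can_unitr bmor_compm1 -compA.
rewrite slift_comp compA -coin_dinatural -compA -slift_comp -box_tens_run !compA.
by rewrite -bmor_comp comp1m compm1.
Qed.

(** By dinaturality the inverse braiding on the second factor becomes [cmor K (bwd (braid Y X))] on
    the first, which cancels the [cmor K (braid Y X)] coming from [can_braid]. *)
Lemma coin_mul_braid X Y :
  eprod canonical_mul (coin Y) (coin X) ∘ slift (braid (box (K X) X) (box (K Y) Y)) =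
  eprod canonical_mul (coin X) (coin Y).
Proof.
rewrite !coin_mul -compA -slift_comp -compA box_tens_braid compA -bmor_comp comp1m.
rewrite -[can K Y X ∘ _]comp1m -[bwd _]compm1 bmor_comp -compA slift_comp compA.
rewrite coin_dinatural -compA -slift_comp compA -bmor_comp comp1m can_braid.
by rewrite compA -cmor_comp fwdK cmor_id comp1m.
Qed.

Definition canonical_algebra : algebra A.
Proof.
exists canonical_mul canonical_unit.
- apply: mul_assoc_inj => i j k; rewrite -!coin_irr; exact: coin_mul_assoc.
- apply: mul_unitl_inj => i; rewrite -!coin_irr; exact: coin_mul_unitl.
- apply: mul_unitr_inj => i; rewrite -!coin_irr; exact: coin_mul_unitr.
Defined.

Lemma coin_alg_mul X Y :
  eprod (alg_mul canonical_algebra) (coin X) (coin Y) =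
  coin (X ⊗ Y) ∘ slift (bmor box (can K X Y) Id ∘ box_tens).
Proof. exact: coin_mul. Qed.

Lemma canonical_algebra_comm : commutative_algebra canonical_algebra.
Proof.
apply: mul_comm_inj => i j; rewrite -!coin_irr; exact: coin_mul_braid.
Qed.

End CanonicalAlgebra.

(** * The unit component of the Deligne product *)

Section Functors.
Variable F : fieldType.

Definition linfun_id (E : lincat F) : linfun E E :=
  @LinFun F E E id (fun _ _ => id) (fun _ => erefl) (fun _ _ _ _ _ => erefl)
    (fun _ _ _ _ _ => erefl).

Definition linfun_comp (E1 E2 E3 : lincat F) (H2 : linfun E2 E3) (H1 : linfun E1 E2) :
  linfun E1 E3.
Proof.
exists (fun V => H2 (H1 V)) (fun V W (f : Mor V W) => fmor H2 (fmor H1 f)).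
- by move=> V; rewrite !fmor_id.
- by move=> V W U g f; rewrite !fmor_comp.
- by move=> V W c f g; rewrite !fmor_lin.
Defined.

Lemma fmor0 (E1 E2 : lincat F) (H : linfun E1 E2) (V W : E1) : fmor H (0 : Mor V W) = 0.
Proof. by have := fmor_lin H (-1) (0 : Mor V W) 0; rewrite scaleN1r addNr scaleN1r addNr. Qed.

End Functors.

Section UnitComponent.
Variables (F : fieldType) (C : brcat F).
Hypotheses (C_tensor : tensor_category C) (C_unit : simple (𝟙 : C)).
Hypotheses (C_schur : schur C) (C_semisimple : semisimple C).
Variables (I : choiceType) (irr : I -> C).
Hypothesis irrP : irr_representatives irr.
Variables (D : brcat F) (box : bilfun C C D).
Hypothesis box_deligne : deligne_product box.
Implicit Types X Y Z : C.
Local Notation Id := (idm _).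
Local Notation dec := (dec C_semisimple irrP).

Let C_abelian : is_abelian C := proj1 C_tensor.

(** Inverse isomorphisms if [irr j] is isomorphic to [𝟙], and zero maps otherwise, so that sums may
    run over all summands. *)
Fact irr_unit_exists j : exists w : Mor 𝟙 (irr j) * Mor (irr j) 𝟙,
  (w.2 ∘ w.1 = Id \/ w.1 = 0 /\ w.2 = 0) /\
  (forall f : Mor (irr j) 𝟙, f ∘ (w.1 ∘ w.2) = f).
Proof.
have [[f]|n] := pselect (isomorphic 𝟙 (irr j)).
  exists (fwd f, bwd f); rewrite /= bwdK fwdK.
  by split; [left | move=> g; rewrite compm1].
exists (0, 0); split; [by right | move=> g].
rewrite (simple_mor0 C_abelian g (irr_simple irrP j) C_unit) ?comp0m //.
by move/isomorphic_sym.
Qed.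

Definition irr_unit j := projT1 (cid (irr_unit_exists j)).

Let irr_unitP j := projT2 (cid (irr_unit_exists j)).

(** Apart from zero entries, [uin] and [uout] are dual bases of [Hom(𝟙, X)] and [Hom(X, 𝟙)]. *)
Definition uin X k : Mor 𝟙 X := locked (inc (dec X) k ∘ (irr_unit (dec_ix (dec X) k)).1).
Definition uout X k : Mor X 𝟙 := locked ((irr_unit (dec_ix (dec X) k)).2 ∘ prj (dec X) k).

Lemma uinE X k : uin k = inc (dec X) k ∘ (irr_unit (dec_ix (dec X) k)).1.
Proof. by rewrite /uin -lock. Qed.

Lemma uoutE X k : uout k = (irr_unit (dec_ix (dec X) k)).2 ∘ prj (dec X) k.
Proof. by rewrite /uout -lock. Qed.

(* The projector onto the isotypic component of [𝟙] in [X], natural in [X]. *)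
Definition upi X : Mor X X := \sum_k uin k ∘ uout k.

Lemma upi_out X (f : Mor X 𝟙) : f ∘ upi X = f.
Proof.
rewrite -[RHS]compm1 -(sum_inc_prj (dec X)) !comp_sumr; apply: eq_bigr => k _.
have [_ wf] := irr_unitP (dec_ix (dec X) k).
by rewrite uinE uoutE !compA -(compA (_ ∘ _) (irr_unit _).1) wf.
Qed.

Lemma upi_one : upi 𝟙 = Id.
Proof. by rewrite -[LHS]comp1m upi_out. Qed.

(** With [uret], this factors the projector [upi X] on the first factor through [box 𝟙 (X ⊗ Y)], an
    expression in [tens] to which the universal property applies. *)
Definition usec X Y : Mor (box 𝟙 (X ⊗ Y)) (box X Y) :=
  \sum_k bmor box (uin k) (lun Y ∘ (uout k ⊗ₘ Id)).

Definition uret X Y : Mor (box X Y) (box 𝟙 (X ⊗ Y)) :=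
  \sum_k bmor box (uout k) ((uin k ⊗ₘ Id) ∘ bwd (lun Y)).

Lemma uout_in X (k : 'I_(dec_n (dec X))) :
  uout k ∘ uin k = Id \/ uin k = 0 /\ uout k = 0.
Proof.
rewrite uinE uoutE; have [[wf|[-> ->]] _] := irr_unitP (dec_ix (dec X) k).
  by left; rewrite -!compA (compA (prj _ _)) prj_inc comp1m wf.
by right; rewrite compm0 comp0m.
Qed.

Lemma uout_in0 X (k l : 'I_(dec_n (dec X))) : l != k -> uout k ∘ uin l = 0.
Proof.
move=> lk; have [_ pi0 _] := decomp_dirsum (dec X).
by rewrite uinE uoutE -!compA (compA (prj _ _)) pi0 // comp0m compm0.
Qed.

Lemma usecK X Y : usec X Y ∘ uret X Y = bmor box (upi X) Id.
Proof.
rewrite /usec comp_suml /upi bmor_suml; apply: eq_bigr => k _.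
rewrite /uret comp_sumr (bigD1 k) //= big1 => [|l lk].
  rewrite addr0 -bmor_comp -!compA (compA (_ ⊗ₘ Id) (_ ⊗ₘ Id)) -bmor_compm1.
  have [->|[-> _]] := uout_in k; last by rewrite comp0m !bmor0l.
  by rewrite bmor_id comp1m fwdK.
rewrite -bmor_comp -!compA (compA (_ ⊗ₘ Id) (_ ⊗ₘ Id)) -bmor_compm1.
by rewrite uout_in0 // bmor0l comp0m compm0 bmor0r.
Qed.

(** Naturality in [X] is an instance of [decomp_dinatural], the unit maps of each [irr j] being
    absorbed into [b]. *)
Lemma usec_nat X X' Y Y' (f : Mor X X') (g : Mor Y Y') :
  usec X' Y' ∘ bmor box Id (f ⊗ₘ g) = bmor box f g ∘ usec X Y.
Proof.
rewrite /usec comp_suml comp_sumr.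
pose b j (p : Mor (irr j) X') (q : Mor X (irr j)) : Mor (box 𝟙 (X ⊗ Y)) (box X' Y') :=
  bmor box (p ∘ (irr_unit j).1) (lun Y' ∘ (((irr_unit j).2 ∘ q) ⊗ₘ g)).
transitivity (\sum_k b _ (inc (dec X') k) (prj (dec X') k ∘ f)).
  by apply: eq_bigr => k _; rewrite /b uinE uoutE -bmor_comp compm1 -compA -bmor_comp comp1m -compA.
rewrite -(decomp_dinatural C_abelian C_schur irrP (dec X)).
- apply: eq_bigr => k _; rewrite /b uinE uoutE -bmor_comp -compA.
  by rewrite (compA g) -lun_nat -compA -bmor_comp comp1m compm1.
- by move=> j c p p' q; rewrite /b comp_linl bmor_linl.
- by move=> j c p q q'; rewrite /b comp_linr bmor_linl comp_linr bmor_linr.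
Qed.

Lemma uret_nat X X' Y Y' (f : Mor X X') (g : Mor Y Y') :
  uret X' Y' ∘ bmor box f g = bmor box Id (f ⊗ₘ g) ∘ uret X Y.
Proof.
have lun_bwd_nat : bwd (lun Y') ∘ g = (Id ⊗ₘ g) ∘ bwd (lun Y).
  by apply: (iso_epi_eq (f := lun Y')); rewrite fwd_bwd_comp compA lun_nat -compA fwdK compm1.
rewrite /uret comp_suml comp_sumr.
pose b j (p : Mor (irr j) X') (q : Mor X (irr j)) : Mor (box X Y) (box 𝟙 (X' ⊗ Y')) :=
  bmor box ((irr_unit j).2 ∘ q) (((p ∘ (irr_unit j).1) ⊗ₘ g) ∘ bwd (lun Y)).
transitivity (\sum_k b _ (inc (dec X') k) (prj (dec X') k ∘ f)).
  apply: eq_bigr => k _; rewrite /b uinE uoutE -bmor_comp -!compA lun_bwd_nat.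
  by rewrite (compA (_ ⊗ₘ Id)) -bmor_comp compm1 comp1m.
rewrite -(decomp_dinatural C_abelian C_schur irrP (dec X)).
- apply: eq_bigr => k _; rewrite /b uinE uoutE -bmor_comp comp1m compA -bmor_comp compm1.
  by rewrite compA.
- by move=> j c p p' q; rewrite /b comp_linl bmor_linl comp_linl bmor_linr.
- by move=> j c p q q'; rewrite /b comp_linr bmor_linl.
Qed.

Definition box_one : linfun C D.
Proof.
exists (fun V => box 𝟙 V) (fun X Y f => bmor box Id f).
- by move=> X; rewrite bmor_id.
- by move=> X Y Z g f; rewrite bmor_comp1m.
- by move=> X Y c f g; rewrite bmor_linr.
Defined.

(* The universal property with target [C] turns [tens] into a functor [H], and
   its full faithfulness with target [D] extends [usec] and [uret] from the objects
   [box X Y] to natural maps on all of [D]. *)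
Lemma unit_projector : exists (H : linfun D C)
    (s : forall W, Mor (box 𝟙 (H W)) W) (t : forall W, Mor W (box 𝟙 (H W)))
    (b : forall X Y, iso (H (box X Y)) (X ⊗ Y)),
  [/\ forall W W' (f : Mor W W'), s W' ∘ bmor box Id (fmor H f) = f ∘ s W,
      forall W W' (f : Mor W W'), t W' ∘ f = bmor box Id (fmor H f) ∘ t W,
      forall X Y, s (box X Y) = usec X Y ∘ bmor box Id (b X Y),
      forall X Y, t (box X Y) = bmor box Id (bwd (b X Y)) ∘ uret X Y
    & forall X Y, s (box X Y) ∘ t (box X Y) = bmor box (upi X) Id].
Proof.
have [D_abelian box_exact univ] := box_deligne.
have [ess _] := univ C C_abelian.
have [H [H_exact [b b_nat]]] := ess (tens : bilfun C C C) (proj2 C_tensor).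
have [_ full] := univ D D_abelian.
pose LH := linfun_comp box_one H.
have LH_exact : right_exact LH.
  move=> X Y Q f q fq; apply: (proj2 box_exact 𝟙); exact: H_exact.
have id_exact : right_exact (linfun_id D) by [].
pose S X Y : Mor (postcomp LH box X Y) (postcomp (linfun_id D) box X Y) :=
  usec X Y ∘ bmor box Id (fwd (b X Y)).
pose T X Y : Mor (postcomp (linfun_id D) box X Y) (postcomp LH box X Y) :=
  bmor box Id (bwd (b X Y)) ∘ uret X Y.
have S_nat : binatural S.
  move=> X1 Y1 X2 Y2 f g; rewrite /S /= -compA -bmor_comp1m.
  have := b_nat _ _ _ _ f g => /= ->.
  by rewrite bmor_comp1m compA usec_nat compA.
have T_nat : binatural T.
  move=> X1 Y1 X2 Y2 f g; rewrite /T /= -compA uret_nat !compA -!bmor_comp1m.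
  congr (bmor box Id _ ∘ _); apply: (iso_epi_eq (f := b Y1 Y2)).
  rewrite fwd_bwd_comp compA; have := b_nat _ _ _ _ f g => /= ->.
  by rewrite -compA fwdK compm1.
have [s [s_nat sE _]] := full _ _ LH_exact id_exact S S_nat.
have [t [t_nat tE _]] := full _ _ id_exact LH_exact T T_nat.
exists H, s, t, b; split=> // X Y; rewrite sE tE.
rewrite /S /T /= -compA (compA (bmor _ _ _) (bmor _ _ _)) -bmor_comp1m fwdK bmor_id.
by rewrite comp1m usecK.
Qed.

(** [H] sends [f] to a nonzero map into a copy of [𝟙], which splits in [C]; [s] and [t] carry the
    section back to [D]. *)
Lemma unit_split (W : D) (f : Mor W (box 𝟙 𝟙)) :
  f <> 0 -> exists g, f ∘ g = Id.
Proof.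
have [H [s [t [b [s_nat t_nat sE tE st]]]]] := unit_projector => f0.
have st1 : s (box 𝟙 𝟙) ∘ t (box 𝟙 𝟙) = Id by rewrite st upi_one bmor_id.
have Hf : fmor H f <> 0.
  move=> Hf0; apply: f0.
  by rewrite -[LHS]comp1m -st1 -compA t_nat Hf0 bmor0r comp0m compm0.
have H1 : simple (H (box 𝟙 𝟙)).
  apply: simple_isomorphic C_unit; apply: isomorphic_sym.
  by exists; apply: iso_comp (lun 𝟙) (b 𝟙 𝟙).
have [g fg] := nonzero_split_epi C_abelian C_semisimple H1 Hf.
exists (s W ∘ bmor box Id g ∘ t (box 𝟙 𝟙)).
by rewrite !compA -s_nat -!compA (compA (bmor _ _ _)) -bmor_comp1m fg bmor_id comp1m.
Qed.

Lemma box_one_nonzero : ~ is_zero (box 𝟙 𝟙).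
Proof.
have [H [s [t [b _]]]] := unit_projector => z; have [n _] := C_unit.
apply: (iso_nonzero (X := 𝟙) (Y := H (box 𝟙 𝟙))) n _.
  by apply: isomorphic_sym; exists; apply: iso_comp (lun 𝟙) (b 𝟙 𝟙).
by rewrite /is_zero -fmor_id z fmor0.
Qed.

Lemma box_unit_mor_sum (T : Type) (r : seq T) X Y (f : T -> Mor (box 𝟙 X) (box 𝟙 Y)) :
  (forall i, exists v, f i = bmor box Id v) ->
  exists v, \sum_(i <- r) f i = bmor box Id v.
Proof.
move=> H; apply: (big_ind (fun g => exists v, g = bmor box Id v)) => //.
- by exists 0; rewrite bmor0r.
- by move=> _ _ [v ->] [w ->]; exists (v + w); rewrite bmorDr.
Qed.

(** Inserting [s ∘ t] writes [f] as a composite of maps [bmor box Id _], because endomorphisms of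
    [𝟙] are scalars and move to the second factor. *)
Lemma box_unit_mor Q (f : Mor (box 𝟙 Q) (box 𝟙 𝟙)) :
  exists v : Mor Q 𝟙, f = bmor box Id v.
Proof.
have [H [s [t [b [s_nat t_nat sE tE st]]]]] := unit_projector.
have scal X Y (u : Mor 𝟙 𝟙) (v : Mor X Y) : exists w, bmor box u v = bmor box Id w.
  by have [c ->] := C_schur C_unit u; exists (c *: v); rewrite bmorZl bmorZr.
have [x xE] : exists x, usec 𝟙 𝟙 = bmor box Id x.
  by apply: box_unit_mor_sum => k; apply: scal.
have [y yE] : exists y, uret 𝟙 Q = bmor box Id y.
  by apply: box_unit_mor_sum => k; apply: scal.
have st1 : s (box 𝟙 Q) ∘ t (box 𝟙 Q) = Id by rewrite st upi_one bmor_id.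
rewrite -[f]compm1 -st1 compA -s_nat sE tE xE yE -!bmor_comp1m.
by eexists.
Qed.

(** The projector is natural and is the identity on [box 𝟙 𝟙], so [f] factors through the unit
    component of [P]; [box_unit_mor] treats each term. *)
Lemma box_mor_unit P Q (f : Mor (box P Q) (box 𝟙 𝟙)) :
  exists n (u : 'I_n -> Mor P 𝟙) (v : 'I_n -> Mor Q 𝟙), f = \sum_k bmor box (u k) (v k).
Proof.
have [H [s [t [b [s_nat t_nat sE tE st]]]]] := unit_projector.
have [v vE] := choice (fun k => box_unit_mor (f ∘ bmor box (uin (X := P) k) (idm Q))).
exists _, (@uout P), v; transitivity (f ∘ bmor box (upi P) Id).
  by rewrite -st compA -s_nat -compA -t_nat compA st upi_one bmor_id comp1m.
rewrite bmor_suml comp_sumr; apply: eq_bigr => k _.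
by rewrite bmor_compm1 compA vE -bmor_comp comp1m compm1.
Qed.

Lemma unit_mor_box0 P Q (f : Mor (box 𝟙 𝟙) (box P Q)) :
  (forall u : Mor 𝟙 P, u = 0) -> f = 0.
Proof.
have [H [s [t [b [s_nat t_nat sE tE st]]]]] := unit_projector => P0.
transitivity (bmor box (upi P) Id ∘ f).
  by rewrite -st -compA t_nat compA s_nat -compA st upi_one bmor_id compm1.
by rewrite /upi big1 ?bmor0l ?comp0m // => k _; rewrite (P0 (uin k)) comp0m.
Qed.

End UnitComponent.

(** * The rigid case *)

Section Rigid.
Variables (F : fieldType) (C : brcat F).
Hypotheses (C_tensor : tensor_category C) (C_unit : simple (𝟙 : C)).
Hypotheses (C_schur : schur C) (C_semisimple : semisimple C).
Variables (K : contragredient C) (I : choiceType) (irr : I -> C).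
Hypothesis irrP : irr_representatives irr.
Variables (D : brcat F) (box : bilfun C C D).
Hypothesis box_deligne : deligne_product box.
Hypothesis box_cw : @componentwise F C (rev_brcat C) D box.
Hypothesis K_dual : duals K.
Implicit Types X Y Z W V : C.
Local Notation Id := (idm _).
Local Notation A := (canonical_object K box irr).
Local Notation dec := (dec C_semisimple irrP).
Let C_abelian : is_abelian C := proj1 C_tensor.
Local Notation bt := (box_tens box_cw).
Local Notation coin := (coin C_semisimple K irrP box).
Local Notation can_algebra := (canonical_algebra C_abelian C_schur C_semisimple K irrP box_cw).

Lemma box_tens_natl (X1 X1' Y1 X2 X2' Y2 : C) (f1 : Mor X1 X1') (f2 : Mor X2 X2') :
  bt ∘ (bmor box f1 f2 ⊗ₘ idm (box Y1 Y2)) = bmor box (f1 ⊗ₘ Id) (f2 ⊗ₘ Id) ∘ bt.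
Proof. by rewrite -(bmor_id box) box_tens_nat. Qed.

Lemma box_tens_natr (X1 Y1 Y1' X2 Y2 Y2' : C) (g1 : Mor Y1 Y1') (g2 : Mor Y2 Y2') :
  bt ∘ (idm (box X1 X2) ⊗ₘ bmor box g1 g2) = bmor box (Id ⊗ₘ g1) (Id ⊗ₘ g2) ∘ bt.
Proof. by rewrite -(bmor_id box) box_tens_nat. Qed.

(** The pairings and coevaluations of [A] and [B] combine into those of [box A B], and the resulting
    zigzag identity recovers [x]. *)
Lemma box_pair_nondegenerate (V : D) A B (x : Mor V (box A B)) :
  bmor box (pair K A) (pair K B) ∘ (bt ∘ (Id ⊗ₘ x)) = 0 -> x = 0.
Proof.
move=> x0; have [cA cAP] := pair_coev K_dual A; have [cB cBP] := pair_coev K_dual B.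
pose c : Mor 𝟙 (box A B ⊗ box (K A) (K B)) :=
  bwd bt ∘ (bmor box cA cB ∘ box_unit box_cw).
have zigzag : bmor box (run A) (run B) ∘ (bt ∘ ((Id ⊗ₘ (bmor box (pair K A) (pair K B) ∘ bt)) ∘
    (bwd (assoc _ _ _) ∘ (c ⊗ₘ Id)))) = lun (box A B).
  have bt_assoc : bt ∘ ((Id ⊗ₘ bt) ∘ bwd (assoc (box A B) (box (K A) (K B)) (box A B))) =
      bmor box (bwd (assoc A (K A) A)) (bwd (assoc B (K B) B)) ∘ (bt ∘ (bt ⊗ₘ Id)).
    apply: (iso_mono_eq (f := assoc _ _ _)); rewrite -!compA bwdK compm1.
    have := box_tens_assoc box_cw A (K A) A B (K B) B; rewrite -!compA => ->.
    by rewrite (compA (bmor box _ _) (bmor box _ _)) -bmor_comp !bwdK bmor_id comp1m.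
  have btc : (bt ⊗ₘ Id) ∘ (c ⊗ₘ Id) = (bmor box cA cB ⊗ₘ Id) ∘ (box_unit box_cw ⊗ₘ idm (box A B)).
    by rewrite -!bmor_compm1 /c fwd_bwd_comp.
  rewrite (bmor_comp1m tens) -!compA (comp_reassoc (box_tens_natr _ _ _ _)) -!compA.
  rewrite (compA (Id ⊗ₘ _) (bwd _)) (compA bt (_ ∘ _)) bt_assoc -!compA btc.
  rewrite (comp_reassoc (box_tens_natl _ _ _ _)) -(box_tens_lun box_cw) -cAP -cBP !bmor_comp.
  by rewrite -!compA.
have lunV : x ∘ lun V = lun (box A B) ∘ (Id ⊗ₘ x) by rewrite lun_nat.
apply: (iso_mono_eq (f := lun V)); rewrite comp0m lunV -zigzag -!compA.
have an : bwd (assoc (box A B) (box (K A) (K B)) (box A B)) ∘ (Id ⊗ₘ x) =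
    (Id ⊗ₘ (Id ⊗ₘ x)) ∘ bwd (assoc _ _ _).
  apply: (iso_epi_eq (f := assoc _ _ _)); rewrite fwd_bwd_comp compA -assoc_nat3.
  by rewrite -compA fwdK compm1.
rewrite tens_interchange (comp_reassoc an) -compA (compA (Id ⊗ₘ _) (Id ⊗ₘ _)) -bmor_comp1m.
by rewrite -compA x0 bmor0r comp0m !compm0.
Qed.

(** Through [cgamma] this is Schur's lemma for the simple object [K X]. *)
Lemma pair_span X (f : Mor (K X ⊗ X) 𝟙) : simple X -> exists c, f = c *: pair K X.
Proof.
move=> Xs; have [c cP] := C_schur (cob_simple K Xs) (cgamma K f).
by exists c; rewrite -(pairK K f) cP bmorZl compZr bmor_id compm1.
Qed.

Lemma pair_orthogonal X Y (f : Mor (K X ⊗ Y) 𝟙) :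
  simple X -> simple Y -> ~ isomorphic X Y -> f = 0.
Proof.
move=> Xs Ys n; rewrite -(pairK K f).
rewrite (simple_mor0 C_abelian (cgamma K f) (cob_simple K Xs) (cob_simple K Ys)) ?bmor0l ?compm0 //.
by move/(cob_inj Xs Ys).
Qed.

Lemma pair_neq0 X : simple X -> pair K X <> 0.
Proof.
move=> Xs p0; have [n _] := cob_simple K Xs; apply: n.
by rewrite /is_zero -(cgamma_pair K X) p0 cgamma0.
Qed.

Lemma box_pair_span X (f : Mor (box (K (K X)) (K X) ⊗ box (K X) X) (box 𝟙 𝟙)) :
  simple X -> exists c, f = c *: (bmor box (pair K (K X)) (pair K X) ∘ bt).
Proof.
move=> Xs.
have [n [u [v uvE]]] := box_mor_unit C_tensor C_unit C_schur C_semisimple irrP box_deligne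
  (f ∘ bwd bt).
have -> : f = (f ∘ bwd bt) ∘ bt by rewrite -compA bwdK compm1.
suff [c ->] : exists c, f ∘ bwd bt = c *: bmor box (pair K (K X)) (pair K X).
  by exists c; rewrite compZl.
rewrite uvE; apply: (big_ind (fun g => exists c, g = c *: bmor box _ _)).
- by exists 0; rewrite scale0r.
- by move=> _ _ [c ->] [d ->]; exists (c + d); rewrite scalerDl.
move=> k _; have [c ->] := pair_span (u k) (cob_simple K Xs).
by have [d ->] := pair_span (v k) Xs; exists (c * d); rewrite bmorZl bmorZr scalerA.
Qed.

(** The nondegenerate pairing embeds the endomorphisms into a space of forms which [box_pair_span]
    shows to be spanned by one element. *)
Lemma box_mor_scalar X (f : Mor (box (K X) X) (box (K X) X)) :
  simple X -> exists c, f = c *: Id.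
Proof.
move=> Xs.
have [c cE] := box_pair_span (bmor box (pair K (K X)) (pair K X) ∘ bt ∘ (Id ⊗ₘ f)) Xs.
exists c; apply/eqP; rewrite -subr_eq0; apply/eqP; apply: box_pair_nondegenerate.
rewrite !compA -scaleN1r bmorDr !bmorZr bmor_id compDr !compZr cE compm1.
by rewrite scaleN1r subrr.
Qed.

Lemma box_mor0 X Y (f : Mor (box (K X) X) (box (K Y) Y)) :
  simple X -> simple Y -> ~ isomorphic X Y -> f = 0.
Proof.
move=> Xs Ys n; apply: box_pair_nondegenerate.
set g := _ ∘ _; have [m [u [v uvE]]] := box_mor_unit C_tensor C_unit C_schur
  C_semisimple irrP box_deligne (g ∘ bwd bt).
have -> : g = (g ∘ bwd bt) ∘ bt by rewrite -compA bwdK compm1.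
rewrite uvE big1 ?comp0m // => k _.
rewrite (pair_orthogonal (v k) Ys Xs) ?bmor0r //.
by move/isomorphic_sym.
Qed.

(** The pairing onto the nonzero object [box 𝟙 𝟙] is a split epimorphism and factors through a
    tensor product with [box (K X) X]. *)
Lemma box_simple_nonzero X : simple X -> ~ is_zero (box (K X) X).
Proof.
move=> Xs z; have n := box_one_nonzero C_tensor C_unit C_schur C_semisimple irrP box_deligne.
have [u uP] := nonzero_split_epi C_abelian C_semisimple C_unit (pair_neq0 (cob_simple K Xs)).
have [v vP] := nonzero_split_epi C_abelian C_semisimple C_unit (pair_neq0 Xs).
apply: n; rewrite /is_zero.
have <- : bmor box (pair K (K X) ∘ u) (pair K X ∘ v) = Id by rewrite uP vP bmor_id.
rewrite bmor_comp -[X in X ∘ _]compm1 -(fwdK bt) -[X in _ ∘ (X ∘ _)]compm1 -(bmor_id tens).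
by rewrite z bmor0r compm0 comp0m compm0 comp0m.
Qed.

Lemma elt_coin0 X i : (forall f : Mor X (irr i), f = 0) -> elt (coin X) i = 0.
Proof.
move=> f0; rewrite /coin elt_sum big1 // => k _; rewrite elt_slift.
have [e|e] := dec_ix (dec X) k =P i; last by rewrite elt_inj0 ?comp0m.
suff -> : prj (dec X) k = 0 by rewrite bmor0r compm0.
by move: (prj _ k); case: i / e f0.
Qed.

(** Each projection onto a copy of [irr i] is a multiple of [th], so the component collapses to a
    single term. *)
Lemma elt_coin X i (th : Mor X (irr i)) :
  th <> 0 -> (forall f : Mor X (irr i), exists c, f = c *: th) ->
  exists u : Mor (irr i) X, u <> 0 /\ elt (coin X) i = bmor box (cmor K u) th.
Proof.
move=> th0 span.
have [u uE] : exists u : Mor (irr i) X, elt (coin X) i = bmor box (cmor K u) th.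
  rewrite /coin elt_sum.
  apply: (big_ind (fun g => exists u : Mor (irr i) X, g = bmor box (cmor K u) th)).
  - by exists 0; rewrite cmor0 bmor0l.
  - by move=> _ _ [u ->] [v ->]; exists (u + v); rewrite cmorD bmorDl.
  move=> k _; rewrite elt_slift.
  have [e|e] := dec_ix (dec X) k =P i; last first.
    by exists 0; rewrite elt_inj0 // comp0m cmor0 bmor0l.
  move: (prj _ k) (inc _ k); case: i / e th {th0} span => th span f g.
  have [c ->] := span f; exists (c *: g).
  by rewrite elt_inj_id comp1m cmorZ bmorZl bmorZr.
(* Otherwise dinaturality along [th], combined with a section of [th], would make the identity of
   the summand [i] vanish. *)
exists u; split=> // u0.
have [s thE] := nonzero_split_epi C_abelian C_semisimple (irr_simple irrP i) th0.
apply: (box_simple_nonzero (irr_simple irrP i)).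
have := elt_inj_id (X := A) i.
rewrite /is_zero => <-; rewrite -(coin_irr C_abelian C_schur C_semisimple).
transitivity (elt (coin (irr i) ∘ slift (bmor box Id (th ∘ s))) i).
  by rewrite thE bmor_id slift_id compm1.
rewrite bmor_comp1m slift_comp compA coin_dinatural // !elt_slift uE u0.
by rewrite cmor0 bmor0l !comp0m.
Qed.

Lemma coin_iso X Y (w : iso X Y) :
  coin X = coin Y ∘ slift (bmor box (cmor K (bwd w)) w).
Proof.
have -> : bmor box (cmor K (bwd w)) w = bmor box (cmor K (bwd w)) Id ∘ bmor box Id w.
  by rewrite -bmor_comp comp1m compm1.
by rewrite slift_comp compA -coin_dinatural // -compA -slift_comp -bmor_comp1m bwdK
  bmor_id slift_id compm1.
Qed.

Definition unit_ix : I := projT1 (cid (let: And3 _ _ H := irrP in H 𝟙 C_unit)).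

Definition unit_ix_iso : iso 𝟙 (irr unit_ix) :=
  inhabited_witness (projT2 (cid (let: And3 _ _ H := irrP in H 𝟙 C_unit))).

Lemma cmor_iso_is_iso X Y (f : iso X Y) :
  cmor K f ∘ cmor K (bwd f) = Id /\ cmor K (bwd f) ∘ cmor K f = Id.
Proof. by rewrite -!cmor_comp bwdK fwdK !cmor_id. Qed.

Definition cmor_iso X Y (f : iso X Y) : iso (K Y) (K X) :=
  Iso (proj2 (cmor_iso_is_iso f)) (proj1 (cmor_iso_is_iso f)).

(** [can_unit] represents the isomorphism [lun 𝟙], so it is a nonzero map between simple objects. *)
Lemma cob_unit : isomorphic (K 𝟙) 𝟙.
Proof.
apply: isomorphic_sym.
apply: is_iso_isomorphic (simple_mor_iso (f := can_unit K) C_abelian C_unit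
  (cob_simple K C_unit) _).
rewrite /can_unit => u0; have [n _] := C_unit; apply: n.
have : lun (𝟙 : C) = 0 :> Mor _ _ by rewrite -(pairK K (lun 𝟙)) u0 bmor0l compm0.
by rewrite /is_zero -(fwdK (lun 𝟙)) => ->; rewrite comp0m.
Qed.

Definition unit_ix_coiso : iso (K (irr unit_ix)) 𝟙 :=
  iso_comp (inhabited_witness cob_unit) (cmor_iso unit_ix_iso).

Definition unit_summand : iso (box (K (irr unit_ix)) (irr unit_ix)) (box 𝟙 𝟙) :=
  bmor_iso box unit_ix_coiso (iso_sym unit_ix_iso).

Lemma elt_coin_mul Y i m (V : D) (g : Mor V (A m)) :
  elt (eprod (alg_mul can_algebra) (coin Y) (dinj (X := A) m ∘ slift g)) i =
  elt (coin (Y ⊗ irr m)) i ∘ (bmor box (can K Y (irr m)) Id ∘ bt ∘ (Id ⊗ₘ g)).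
Proof.
rewrite -{1}[coin Y]compm1 -slift_id eprod_slift.
by rewrite -(coin_irr C_abelian C_schur C_semisimple) coin_alg_mul !elt_slift -!compA.
Qed.

(* The component of the product at the unit summand is a nondegenerate form: its
   restriction to the summands of [K X] and [X] is the evaluation of [box (K X) X],
   up to a nonzero scalar. *)
Lemma mul_nondegenerate (V : D) (x : Mor (single V) A) :
  (forall k, elt (eprod (alg_mul can_algebra) (dinj (X := A) k) x) unit_ix = 0) -> x = 0.
Proof.
move=> x0.
have coin0 Y : elt (eprod (alg_mul can_algebra) (coin Y) x) unit_ix = 0.
  rewrite -(compm1 x) -slift_id /coin eprod_suml elt_sum big1 // => k _.
  by rewrite eprod_slift elt_slift x0 comp0m.
apply: elt_inj => i; rewrite elt0; apply: contrapT => xi.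
have [r ur rP] := ent_seq x tt.
have ir : i \in r by apply/rP/eqP.
pose X := irr i; have Xs : simple X := irr_simple irrP i.
pose th : Mor (K X ⊗ X) (irr unit_ix) := unit_ix_iso ∘ pair K X.
have thE : bwd unit_ix_iso ∘ th = pair K X by rewrite /th bwd_fwd_comp.
have th0 : th <> 0.
  by move=> e; apply: (pair_neq0 Xs); rewrite -thE e compm0.
have th_span (f : Mor (K X ⊗ X) (irr unit_ix)) : exists c, f = c *: th.
  have [c cE] := pair_span (bwd unit_ix_iso ∘ f) Xs; exists c.
  by rewrite /th -compZr -cE fwd_bwd_comp.
have [u [u0 uE]] := elt_coin th0 th_span.
(* In the product with [coin (K X)] only the component of [x] at [i] reaches the unit summand:
   [K X ⊗ irr m] has no nonzero map to [𝟙] for [m != i]. *)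
have e0 : bmor box (cmor K u) th ∘ (bmor box (can K (K X) X) Id ∘ bt ∘ (Id ⊗ₘ elt x i)) = 0.
  rewrite -uE -elt_coin_mul -[RHS](coin0 (K X)) [in RHS](inj_expand ur rP).
  rewrite eprod_sumr elt_sum (bigD1_seq i) // big1 => [|m mi].
    by rewrite [RHS]addr0.
  rewrite elt_coin_mul elt_coin0 ?comp0m // => f.
  rewrite -[LHS]comp1m -(fwdK unit_ix_iso) -compA.
  rewrite (pair_orthogonal (bwd unit_ix_iso ∘ f) Xs (irr_simple irrP m)) ?compm0 //.
  by case: irrP => _ inj _ /inj im; rewrite im eqxx in mi.
(* The first tensor factor is thus a multiple of the pairing of [K X], and the multiple is nonzero
   by nondegeneracy of [can]. *)
have [c cE] := pair_span (unit_ix_coiso ∘ (cmor K u ∘ can K (K X) X)) (cob_simple K Xs).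
have c0 : c <> 0.
  move=> c0; apply/u0/(can_nondegenerate K_dual).
  by rewrite -[LHS](bwd_fwd_comp unit_ix_coiso) cE c0 scale0r compm0.
apply: xi; apply: box_pair_nondegenerate.
apply: (scalerI (a := c)); first by apply/eqP.
rewrite scaler0 -compZl -bmorZl -cE -thE.
have := congr1 (fun g => unit_summand ∘ g) e0; rewrite compm0 => <-.
by rewrite !compA -!bmor_comp compm1 -!compA.
Qed.

Lemma unit_mor_summand0 m (f : Mor (box 𝟙 𝟙) (A m)) : m != unit_ix -> f = 0.
Proof.
move=> mu; apply: (unit_mor_box0 C_tensor C_unit C_schur C_semisimple irrP box_deligne) => g.
apply: (simple_mor0 C_abelian) => //; first exact/cob_simple/(irr_simple irrP).
move=> e; have ee : isomorphic (K (irr unit_ix)) (K (irr m)).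
  by apply: isomorphic_trans e; exists; exact: unit_ix_coiso.
have [_ inj _] := irrP; move/eqP: mu; apply; apply/esym/inj.
by apply: cob_inj ee; apply: irr_simple irrP _.
Qed.

Lemma canonical_algebra_simple : simple_algebra can_algebra.
Proof.
move=> J j [jm jl jr]; have [z|nz] := pselect (is_zero J); [by left | right].
have [s xs] : exists s, j ∘ dinj s <> 0.
  apply: contrapT => /forallNP H; apply: nz; apply: jm; rewrite compm0 compm1.
  by apply: inj_ext => s; rewrite comp0m (contrapT (H s)).
have [k fk] : exists k,
    elt (eprod (alg_mul can_algebra) (dinj (X := A) k) (j ∘ dinj s)) unit_ix <> 0.
  by apply: contrapT => /forallNP H; apply/xs/mul_nondegenerate => k; apply: contrapT (H k).
set x := eprod _ _ _ in fk.
have [g gE] : exists g, unit_summand ∘ elt x unit_ix ∘ g = Id.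
  apply: (unit_split C_tensor C_unit C_schur C_semisimple irrP box_deligne) => e.
  by apply: fk; rewrite -[LHS](bwd_fwd_comp unit_summand) e compm0.
(* All other components die after composition with [g], since [box 𝟙 𝟙] has no nonzero map to the
   other summands. *)
have xE : x ∘ slift (g ∘ unit_summand) = dinj (X := A) unit_ix.
  apply: elt_inj => m; rewrite elt_slift.
  have [->|mu] := eqVneq m unit_ix.
    apply: etrans (esym (elt_inj_id (X := A) unit_ix)).
    apply: (iso_epi_eq (f := unit_summand)).
    by rewrite !compA gE comp1m compm1.
  have mu' : unit_ix <> m by move/esym/eqP; rewrite (negbTE mu).
  apply: etrans (esym (elt_inj0 (X := A) mu')).
  by rewrite compA (unit_mor_summand0 (elt x m ∘ g)) ?comp0m.
have [l lE] := jl; have [r rE] := jr.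
have [h hE] : exists h, j ∘ h = dinj (X := A) unit_ix.
  rewrite -xE /x /eprod -{1}[dinj k]comp1m etens_mor compA -lE -!compA.
  by eexists.
(* The unit of the algebra factors through the unit summand, hence through the ideal. *)
have [h' h'E] : exists h', j ∘ h' = alg_unit can_algebra.
  exists (h ∘ slift (bmor box (cmor K (bwd unit_ix_iso)) unit_ix_iso) ∘
    slift (bmor box (can_unit K) Id ∘ box_unit box_cw)).
  rewrite 2!compA hE; congr (_ ∘ _).
  by rewrite -(coin_irr C_abelian C_schur C_semisimple) -coin_iso.
(* Multiplying the unit inside the ideal by [A] on the right yields a section of [j]. *)
apply: (split_mono_iso jm) (_ : j ∘ (r ∘ (h' ⊗ₘ Id) ∘ bwd (lun A)) = Id).
by rewrite !compA rE -(compA (alg_mul _)) -bmor_compm1 h'E alg_unitl fwdK.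
Qed.

(** There are only scalar maps between the summands of [A]; hence the multiplication rules do not
    depend on the chosen embeddings. *)
Lemma mor_coin_scalar X (p : Mor (single (box (K X) X)) A) :
  simple X -> exists c, p = c *: coin X.
Proof.
move=> Xs; have [_ _ /(_ X Xs)[i [w]]] := irrP.
pose p' := p ∘ slift (bmor box (cmor K w) (bwd w)).
have [c cE] := box_mor_scalar (elt p' i) (irr_simple irrP i).
have p'E : p' = c *: coin (irr i).
  apply: elt_inj => m; rewrite eltZ (coin_irr C_abelian C_schur C_semisimple).
  have [<-|im] := i =P m; first by rewrite cE (elt_inj_id (X := A) i).
  rewrite (elt_inj0 (X := A) im) scaler0.
  apply: (box_mor0 (X := irr i) (Y := irr m)); try exact: irr_simple irrP _.
  by case: irrP => _ inj _ /inj.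
exists c; rewrite (coin_iso w) -compZl -p'E /p' -compA -slift_comp -bmor_comp.
by rewrite -cmor_comp !bwdK cmor_id bmor_id slift_id compm1.
Qed.

Lemma mono_coin_scalar X (p : Mor (single (box (K X) X)) A) :
  simple X -> mono p -> exists2 c, c <> 0 & p = c *: coin X.
Proof.
move=> Xs pm; have [c cE] := mor_coin_scalar p Xs; exists c => // c0.
apply: (box_simple_nonzero Xs); rewrite /is_zero -[LHS]elt_sliftE.
rewrite (_ : slift _ = 0) //; apply: pm.
by rewrite cE c0 scale0r !comp0m.
Qed.

Lemma dec_ix_nonzero X i (f : Mor X (irr i)) : f <> 0 -> exists k, dec_ix (dec X) k = i.
Proof.
move=> f0; apply: contrapT => /forallNP H; apply: f0.
rewrite -[LHS]compm1 -(sum_inc_prj (dec X)) comp_sumr big1 // => k _.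
by rewrite compA (irr_mor0 C_abelian irrP (f ∘ _)) ?comp0m //; apply/eqP/H.
Qed.

Lemma elt_coin_out X i : (forall k, dec_ix (dec X) k <> i) -> elt (coin X) i = 0.
Proof.
move=> H; rewrite /coin elt_sum big1 // => k _.
by rewrite elt_slift elt_inj0 ?comp0m //; apply: H.
Qed.

(** The image is exhibited as a partial sum of [A]: the other components of the product vanish, and
    the product has a section over each summand retained. *)
Lemma canonical_mult_rule X Y Z
    (p : Mor (single (box (K X) X)) A) (q : Mor (single (box (K Y) Y)) A)
    (r : Mor (single (box (K Z) Z)) A) :
  simple X -> simple Y -> simple Z -> mono p -> mono q -> mono r ->
  mult_rule can_algebra p q r = 1%N <-> direct_summand Z (X ⊗ Y).
Proof.
move=> Xs Ys Zs pm qm rm.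
have [cp cp0 pE] := mono_coin_scalar Xs pm.
have [cq cq0 qE] := mono_coin_scalar Ys qm.
have [cr cr0 rE] := mono_coin_scalar Zs rm.
have [_ _ /(_ Z Zs)[z [w]]] := irrP.
set M := alg_mul can_algebra ∘ (p ⊗ₘ q).
have ME : M ∘ single_tens _ _ = (cp * cq) *: (coin (X ⊗ Y) ∘
    slift (bmor box (can K X Y) Id ∘ bt)).
  rewrite -coin_alg_mul -scalerA -eprodZr -eprodZl -pE -qE.
  by rewrite /eprod /etens !compA.
have ent_M i : ent M (tt, tt) i = (cp * cq) *: (elt (coin (X ⊗ Y)) i ∘
    (bmor box (can K X Y) Id ∘ bt)).
  by rewrite -elt_single_tens ME eltZ elt_slift.
have rz_eq : r = cr *: (dinj (X := A) z ∘ slift (bmor box (cmor K (bwd w)) w)).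
  by rewrite rE (coin_iso w) (coin_irr C_abelian C_schur C_semisimple).
have rz : elt r z <> 0.
  rewrite rz_eq eltZ elt_slift (elt_inj_id (X := A) z) comp1m => /eqP.
  rewrite scaler_eq0 => /orP[/eqP //|/eqP w0]; apply: (box_simple_nonzero Zs).
  rewrite /is_zero -(bmor_id box) -(cmor_id K) -(bwdK w) cmor_comp.
  by rewrite bmor_comp w0 compm0.
have r0 i : i <> z -> elt r i = 0.
  move=> iz; rewrite rz_eq eltZ elt_slift (elt_inj0 (X := A)) ?comp0m ?scaler0 //.
  by move/esym.
rewrite /mult_rule; split=> [|[i [o oi]]].
  case: asboolP => // -[J [j [[jm [g gE] jmin] [h hE]]]] _.
  (* Otherwise the product, and so its image and [r], would lie in the sum of the summands other
     than [z], contradicting [rz]. *)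
  have [k kz] : exists k, dec_ix (dec (X ⊗ Y)) k = z.
    apply: contrapT => /forallNP nz; apply: rz.
    pose P : pred I := fun i => i != z.
    have [g' g'E] : factors_through M (sub_in (X := A) P).
      apply: sub_in_factor => -[[] []] i /negPn/eqP -> {i}.
      by rewrite ent_M elt_coin_out // comp0m scaler0.
    have [l lE] := jmin _ _ (@sub_in_mono _ _ A P) (ex_intro _ g' g'E).
    rewrite -hE -lE -compA; apply: (ent_sub_in0 (X := A) (P := P) (l ∘ h) tt).
    by rewrite /P eqxx.
  have [i' [o' oi']] : direct_summand (irr z) (X ⊗ Y).
    by rewrite -kz; exists (inc _ k), (prj _ k); apply: prj_inc.
  exists (i' ∘ w), (bwd w ∘ o').
  by rewrite -compA (compA o') oi' comp1m bwdK.
(* [cmor K u ∘ can K X Y] is nonzero with simple target, so it splits; the scalar in the witness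
   undoes the one in [ME]. *)
have section k : exists h, M ∘ h = dinj (X := A) (dec_ix (dec (X ⊗ Y)) k).
  set u := inc (dec (X ⊗ Y)) k; have us := irr_simple irrP (dec_ix (dec (X ⊗ Y)) k).
  have u0 : cmor K u ∘ can K X Y <> 0.
    move/(can_nondegenerate K_dual) => u0; have [n _] := us; apply: n.
    by rewrite /is_zero -(prj_inc k) -/u u0 compm0.
  have [s sE] := nonzero_split_epi C_abelian C_semisimple (cob_simple K us) u0.
  exists ((cp * cq)^-1 *: (single_tens _ _ ∘ slift (bwd bt ∘ bmor box s u))).
  rewrite compZr compA ME compZl scalerA mulVf ?scale1r; last first.
    by rewrite mulf_neq0 //; apply/eqP.
  rewrite -compA -slift_comp -compA fwd_bwd_comp -bmor_comp comp1m.
  have -> : bmor box (can K X Y ∘ s) u = bmor box Id u ∘ bmor box (can K X Y ∘ s) Id.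
    by rewrite -bmor_comp comp1m compm1.
  rewrite slift_comp compA coin_dinatural // -compA -slift_comp -bmor_compm1.
  by rewrite compA sE bmor_id slift_id compm1 coin_irr.
pose P : pred I := fun i => [exists k, dec_ix (dec (X ⊗ Y)) k == i].
rewrite asboolT //; exists (sub_sum (X := A) P), (sub_in (X := A) P); split.
  split; first exact: sub_in_mono.
    apply: sub_in_factor => -[[] []] m /existsPn Pm.
    by rewrite ent_M elt_coin_out ?comp0m ?scaler0 // => k; apply/eqP.
  move=> J' m' _ [g gE].
  (* Minimality: these sections factor the partial sum through any subobject containing the
     product. *)
  have sec (t : ix (sub_sum (X := A) P)) : exists h, M ∘ h = dinj (X := A) (val t).
    by have /existsP[k /eqP <-] := valP t; apply: section.
  pose h t := projT1 (cid (sec t)).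
  exists (g ∘ copair (X := sub_sum (X := A) P) h); rewrite compA gE.
  apply: inj_ext => t; rewrite -compA copair_inj sub_in_dinj.
  exact: (projT2 (cid (sec t))).
apply: sub_in_factor => -[] m Pm; apply: r0 => mz.
case/negP: Pm; rewrite mz; apply/existsP.
have [|k kz] := @dec_ix_nonzero _ z (w ∘ o); last by exists k; apply/eqP.
move=> wo0; have [n _] := Zs; apply: n.
by rewrite /is_zero -oi -[o](bwd_fwd_comp w) wo0 compm0 comp0m.
Qed.

End Rigid.

Theorem theorem1 (F : fieldType) (C : brcat F)
    (C_tensor : tensor_category C) (C_unit : simple (𝟙 : C))
    (C_schur : schur C) (C_semisimple : semisimple C)
    (K : contragredient C)
    (I : choiceType) (irr : I -> C) (irrP : irr_representatives irr)
    (D : brcat F) (D_tensor : tensor_category D)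
    (box : bilfun C (rev_brcat C) D)
    (box_deligne : deligne_product box) (box_cw : componentwise box) :
  exists m : algebra (canonical_object K box irr),
    commutative_algebra m /\
    (duals K ->
      simple_algebra m /\
      forall (X Y Z : C), simple X -> simple Y -> simple Z ->
      forall (p : Mor (dsingle (box (K X) X) : dsum_brcat D)
                      (canonical_object K box irr))
             (q : Mor (dsingle (box (K Y) Y) : dsum_brcat D)
                      (canonical_object K box irr))
             (r : Mor (dsingle (box (K Z) Z) : dsum_brcat D)
                      (canonical_object K box irr)),
      mono p -> mono q -> mono r ->
      (mult_rule m p q r = 1%N <-> direct_summand Z (X ⊗ Y))).
Proof.
exists (canonical_algebra (proj1 C_tensor) C_schur C_semisimple K irrP box_cw).
split; first exact: canonical_algebra_comm.
move=> K_dual; split.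
  exact: (@canonical_algebra_simple F C C_tensor C_unit C_schur C_semisimple K I irr
    irrP D box box_deligne box_cw K_dual).
move=> X Y Z Xs Ys Zs p q r pm qm rm.
exact: (@canonical_mult_rule F C C_tensor C_unit C_schur C_semisimple K I irr
  irrP D box box_deligne box_cw K_dual X Y Z p q r Xs Ys Zs pm qm rm).
Qed.
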